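(* Let $\Gamma$ be a finite group and $n\ge1$. (i) The class algebra $R(\Gamma_n)$ is generated by the class functions $\Xi_n^i(\alpha)$, where $0\le i<n$ and $\alpha\in\Gamma^*$. (ii) The class algebra $R(\Gamma_n)$ is also generated by the class functions $P_i(\alpha,n)$, where $0\le i<n$ and $\alpha\in\Gamma^*$.
   Context: $\Gamma^*$ is the set of complex irreducible characters of $\Gamma$. A function $f$ on a finite group $G$ is identified with $\sum_x f(x)x\in\mathbb C[G]$; $R(G)$ (the class algebra) is the space of complex class functions = center of $\mathbb C[G]$, a $\mathbb C$-algebra under convolution $\circ$. ''Generated'' means generated as a $\mathbb C$-algebra. $1\in R(\Gamma)$ is the characteristic function of the identity element. $\Gamma_n=\Gamma^n\rtimes S_n$ with $(g,\sigma)(h,\tau)=(g\,\sigma(h),\sigma\tau)$, $\sigma(h)=(h_{\sigma^{-1}(1)},\ldots,h_{\sigma^{-1}(n)})$, $\Gamma_0$ trivial. For $\alpha\in\mathbb C[\Gamma]$, $\alpha^{(i)}\in\mathbb C[\Gamma_n]$ is its copy in the group algebra of the $i$-th factor of $\Gamma^n$. Jucys-Murphy elements: $\xi_j=\sum_{i<j}\sum_aa\in\mathbb C[\Gamma_n]$, $1\le j\le n$, where $a$ runs over elements $((g_1,\ldots,g_n),(i,j))$ with $g_k=1$ for $k\ne i,j$ and $g_j=g_i^{-1}$, $g_i\in\Gamma$. $\Xi_n^k(\alpha)=\sum_{i=1}^n\xi_i^k\circ\alpha^{(i)}\in R(\Gamma_n)$ (with $\xi_i^0=1$). For $r>0$,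 $\gamma\in R(\Gamma)$, let $\sigma_r(\gamma)\in R(\Gamma_r)$ take value $r\gamma(c)$ on elements $(g,s)$ with $s$ an $r$-cycle $(i_1\cdots i_r)$ and cycle-product $g_{i_r}\cdots g_{i_1}$ in the conjugacy class $c$ of $\Gamma$, and $0$ elsewhere; $\mathfrak p_{-r}(\gamma)$ maps $v\in R(\Gamma_m)$ to $\mathrm{Ind}_{\Gamma_r\times\Gamma_m}^{\Gamma_{r+m}}(\sigma_r(\gamma)\otimes v)$. $|0\rangle=1\in R(\Gamma_0)=\mathbb C$. For $0\le i<n$, $\alpha\in R(\Gamma)$, $$P_i(\alpha,n)=\frac1{(n-i-1)!}\,\mathfrak p_{-i-1}(\alpha)\,\mathfrak p_{-1}(1)^{n-i-1}|0\rangle\in R(\Gamma_n).$$ *)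

(* Defs.v *)
From HB Require Import structures.
From mathcomp Require Import all_boot all_order all_algebra all_fingroup all_character.
From mathcomp Require Import boolp classical_sets reals.
From mathcomp.real_closed Require Export complex.
Set Implicit Arguments.
Unset Strict Implicit.
Unset Printing Implicit Defensive.

Import GRing.Theory GroupScope.
Local Open Scope ring_scope.

(* The group algebra F[G]: functions on G under convolution.  The alias is
   needed because {ffun G -> F} already carries the pointwise product. *)
Definition grpalg (F : fieldType) (G : finGroupType) := {ffun G -> F^o}.

HB.instance Definition _ (F : fieldType) (G : finGroupType) :=
  GRing.Lmodule.copy (grpalg F G) {ffun G -> F^o}.

Definition delta (F : fieldType) (G : finGroupType) (x : G) : grpalg F G :=
  [ffun y => (y == x)%:R].

Definition conv (F : fieldType) (G : finGroupType) (f g : grpalg F G) :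
    grpalg F G :=
  [ffun x => \sum_(y : G) f y * g (y^-1 * x)%g].

Section GroupAlgebra.
Variables (F : fieldType) (G : finGroupType).
Implicit Types f g h : grpalg F G.

Fact convA : associative (@conv F G).
Proof.
move=> f g h; apply/ffunP => x; rewrite !ffunE.
under eq_bigr do rewrite ffunE mulr_sumr.
under [RHS]eq_bigr do rewrite ffunE mulr_suml.
rewrite [RHS]exchange_big /=; apply: eq_bigr => y _.
rewrite [RHS](reindex_inj (mulgI y)) /=.
by apply: eq_bigr => z _; rewrite mulrA mulKg invMg mulgA.
Qed.

Fact conv1f : left_id (delta F 1%g) (@conv F G).
Proof.
move=> f; apply/ffunP => x; rewrite ffunE (bigD1 1%g) //= big1 => [|y y1].
  by rewrite ffunE eqxx mul1r invg1 mul1g addr0.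
by rewrite ffunE (negPf y1) mul0r.
Qed.

Fact convf1 : right_id (delta F 1%g) (@conv F G).
Proof.
move=> f; apply/ffunP => x; rewrite ffunE (bigD1 x) //= big1 => [|y yx].
  by rewrite ffunE mulVg eqxx mulr1 addr0.
by rewrite ffunE -eq_mulVg1 (negPf yx) mulr0.
Qed.

Fact convDl : left_distributive (@conv F G) +%R.
Proof.
move=> f g h; apply/ffunP => x; rewrite !ffunE -big_split.
by apply: eq_bigr => y _; rewrite ffunE mulrDl.
Qed.

Fact convDr : right_distributive (@conv F G) +%R.
Proof.
move=> f g h; apply/ffunP => x; rewrite !ffunE -big_split.
by apply: eq_bigr => y _; rewrite ffunE mulrDr.
Qed.

Fact delta1_neq0 : delta F (1%g : G) != 0.
Proof.
apply/eqP => /ffunP/(_ 1%g); rewrite !ffunE eqxx => /eqP.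
by rewrite oner_eq0.
Qed.

HB.instance Definition _ := GRing.Zmodule_isNzRing.Build (grpalg F G)
  convA conv1f convf1 convDl convDr delta1_neq0.

Fact conv_scaleAl (a : F) f g : a *: (f * g) = (a *: f) * g.
Proof.
apply/ffunP => x; rewrite !ffunE scaler_sumr.
by apply: eq_bigr => y _; rewrite ffunE scalerAl.
Qed.

HB.instance Definition _ :=
  GRing.Lmodule_isLalgebra.Build F (grpalg F G) conv_scaleAl.

Fact conv_scaleAr (a : F) f g : a *: (f * g) = f * (a *: g).
Proof.
apply/ffunP => x; rewrite !ffunE scaler_sumr.
by apply: eq_bigr => y _; rewrite ffunE scalerAr.
Qed.

HB.instance Definition _ :=
  GRing.Lalgebra_isAlgebra.Build F (grpalg F G) conv_scaleAr.

End GroupAlgebra.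

Definition class_algebra (F : fieldType) (G : finGroupType) :
    set (grpalg F G) :=
  [set f | forall x y : G, f (x ^ y)%g = f x]%classic.

Definition generated_algebra (F : fieldType) (A : algType F) (S : set A) :
    set A :=
  smallest [set B : set A | GRing.subalg_closed [in B]]%classic S.

Definition irr_char (F : fieldType) (G : finGroupType) : set (grpalg F G) :=
  [set chi | exists d (rG : mx_representation F [set: G]%G d),
     mx_irreducible rG /\ forall g, chi g = \tr (rG g)]%classic.

Definition wreath (G : finGroupType) (n : nat) : Type :=
  ({ffun 'I_n -> G} * 'S_n)%type.

HB.instance Definition _ (G : finGroupType) (n : nat) :=
  Finite.copy (wreath G n) ({ffun 'I_n -> G} * 'S_n)%type.

Section Wreath.
Variables (G : finGroupType) (n : nat).
Implicit Types x y z : wreath G n.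

(* In MathComp (s * t)%g is "s, then t", so that the composite "x.2 after y.2"
   is written (y.2 * x.2)%g. *)
Definition wmul x y : wreath G n :=
  ([ffun i => x.1 i * y.1 (x.2^-1 i)], y.2 * x.2)%g.

Definition wone : wreath G n := ([ffun=> 1], 1)%g.

Definition winv x : wreath G n := ([ffun i => (x.1 (x.2 i))^-1], x.2^-1)%g.

Fact wmulA : associative wmul.
Proof.
move=> x y z; congr (_, _) => /=; last by rewrite mulgA.
by apply/ffunP => i; rewrite !ffunE invMg permM mulgA.
Qed.

Fact wmul1 : left_id wone wmul.
Proof.
move=> [g s]; congr (_, _) => /=; last by rewrite mulg1.
by apply/ffunP => i; rewrite !ffunE invg1 perm1 mul1g.
Qed.

Fact wmulV : left_inverse wone winv wmul.
Proof.
move=> x; congr (_, _) => /=; last by rewrite mulgV.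
by apply/ffunP => i; rewrite !ffunE invgK mulVg.
Qed.

HB.instance Definition _ :=
  Finite_isGroup.Build (wreath G n) wmulA wmul1 wmulV.

End Wreath.

Section Elements.
Variables (F : fieldType) (G : finGroupType) (n : nat).

Definition wreath_base (i : 'I_n) (g : G) : wreath G n :=
  ([ffun k => if k == i then g else 1], 1)%g.

Definition copy_at (i : 'I_n) (alpha : grpalg F G) : grpalg F (wreath G n) :=
  \sum_(g : G) alpha g *: delta F (wreath_base i g).

Definition jm_term (i j : 'I_n) (g : G) : wreath G n :=
  ([ffun k => if k == i then g else if k == j then g^-1 else 1], tperm i j)%g.

Definition jucys_murphy (j : 'I_n) : grpalg F (wreath G n) :=
  \sum_(i < n | (i < j)%N) \sum_(g : G) delta F (jm_term i j g).

Definition Xi (k : nat) (alpha : grpalg F G) : grpalg F (wreath G n) :=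
  \sum_(i < n) jucys_murphy i ^+ k * copy_at i alpha.

End Elements.

(* The cycle product g_{i_r} ... g_{i_1} of the cycle (i_1 ... i_r) of x.2
   with i_1 = i and i_(k+1) = x.2 i_k. *)
Definition cycle_prod (G : finGroupType) (n : nat) (x : wreath G n) (r : nat)
    (i : 'I_n) : G :=
  (\prod_(k < r) x.1 (iter (r - k.+1) x.2 i))%g.

(* sigma r is sigma_{r+1}, supported on (r+1)-cycles.  The cycle is read from
   i_1 = 0; for a class function gamma this choice does not matter. *)
Definition sigma (F : fieldType) (G : finGroupType) (r : nat)
    (gamma : grpalg F G) : grpalg F (wreath G r.+1) :=
  [ffun x => if porbit x.2 ord0 == [set: 'I_r.+1]%SET
             then r.+1%:R * gamma (cycle_prod x r.+1 ord0) else 0].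

(* The block sum 'S_r x 'S_m -> 'S_(r + m). *)
Definition perm_sum_fun (r m : nat) (s : 'S_r) (t : 'S_m) (k : 'I_(r + m)) :
    'I_(r + m) :=
  match split k with
  | inl i => lshift m (s i)
  | inr j => rshift r (t j)
  end.

Fact perm_sum_inj (r m : nat) (s : 'S_r) (t : 'S_m) :
  injective (perm_sum_fun s t).
Proof.
apply: (can_inj (g := perm_sum_fun s^-1%g t^-1%g)) => k.
rewrite /perm_sum_fun -[RHS]splitK; case: (split k) => i /=.
  by rewrite (unsplitK (inl _ (s i))) permK.
by rewrite (unsplitK (inr _ (t i))) permK.
Qed.

Definition perm_sum (r m : nat) (s : 'S_r) (t : 'S_m) : 'S_(r + m) :=
  perm (@perm_sum_inj r m s t).

Definition wreath_sum (G : finGroupType) (r m : nat)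
    (p : wreath G r * wreath G m) : wreath G (r + m) :=
  ([ffun k => match split k with inl i => p.1.1 i | inr j => p.2.1 j end],
   perm_sum p.1.2 p.2.2).

Fact wreath_sumM (G : finGroupType) (r m : nat) :
  {morph @wreath_sum G r m : p q / (p * q)%g}.
Proof.
move=> p q.
have sumK (s : 'S_r) (t : 'S_m) k : ((perm_sum s t)^-1)%g k =
    perm_sum_fun (s^-1)%g (t^-1)%g k.
  apply: (canLR (permK _)); rewrite permE /perm_sum_fun -[LHS]splitK.
  by case: (split k) => i /=; rewrite ?(unsplitK (inl _ _)) ?(unsplitK (inr _ _)) permKV.
congr (_, _).
  apply/ffunP => k; rewrite !ffunE /= sumK /perm_sum_fun.
  by case: (split k) => i; rewrite ?(unsplitK (inl _ _)) ?(unsplitK (inr _ _)) ffunE.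
apply/permP => k; rewrite permM !permE /= /perm_sum_fun.
by case: (split k) => i; rewrite ?(unsplitK (inl _ _)) ?(unsplitK (inr _ _)) permM.
Qed.

(* The induced class function, along an injective morphism phi : H -> G. *)
Definition induced (F : fieldType) (H G : finGroupType) (phi : H -> G)
    (f : grpalg F H) : grpalg F G :=
  [ffun x => #|H|%:R^-1 *
     \sum_(y : G) \sum_(h : H | phi h == (x ^ y)%g) f h].

Definition tensor (F : fieldType) (H K : finGroupType)
    (f : grpalg F H) (g : grpalg F K) : grpalg F (H * K)%type :=
  [ffun p => f p.1 * g p.2].

(* creation r is the operator p_{-(r+1)}. *)
Definition creation (F : fieldType) (G : finGroupType) (r : nat)
    (gamma : grpalg F G) (m : nat) (v : grpalg F (wreath G m)) :
    grpalg F (wreath G (r.+1 + m)) :=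
  induced (@wreath_sum G r.+1 m) (tensor (sigma r gamma) v).

(* p_{-1}(1)^m |0>, where 1 + m is convertible to m.+1. *)
Fixpoint vacuum_power (F : fieldType) (G : finGroupType) (m : nat) :
    grpalg F (wreath G m) :=
  if m is m'.+1 then creation 0 1 (vacuum_power F G m') else 1.

Definition P (F : fieldType) (G : finGroupType) (n : nat) (i : 'I_n)
    (alpha : grpalg F G) : grpalg F (wreath G n) :=
  ((n - i.+1)`!%:R)^-1 *:
  ecast k (grpalg F (wreath G k)) (subnKC (ltn_ord i))
    (creation i alpha (vacuum_power F G (n - i.+1))).

(* Main.v *)
Require Import Defs.
From mathcomp Require Import boolp classical_sets reals.
From mathcomp Require Import all_boot all_order all_algebra all_fingroup.
From mathcomp Require Import pgroup mxrepresentation ring.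
Set Implicit Arguments.
Unset Strict Implicit.
Unset Printing Implicit Defensive.
Import Order.TTheory GRing.Theory Num.Theory.
Local Open Scope group_scope.
Local Open Scope ring_scope.

(* Filter the class functions on the wreath product by the size of the support
   of the elements (the points whose label or position is moved).  The product
   of the class sums of two elements with disjoint supports is a nonzero multiple
   of the class sum of their product, plus class functions of strictly smaller
   support; as every element is a product of disjoint labelled cycles, a
   subalgebra is everything as soon as it contains the class sum of each cycle
   up to smaller support.  Both families have this property: on the elements of
   support larger than [k], [P_k(alpha)] and [Xi^k(alpha)] live on the cycles of
   length [k + 1], where they are a nonzero multiple of [alpha] of the cycle
   product.  For [Xi^k], which is central by the degenerate Hecke relations, this
   holds because a cycle on [k + 1] points is in a unique way a product of [k]
   terms of the Jucys-Murphy element of its largest point. *)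

(** * Wreath products acting on labelled points *)

Section PermExtension.
Local Open Scope group_scope.
Variable T : finType.

(** Induction on the size of [D]: a permutation that agrees with [p] on [D] minus [k] is corrected
    at [k] by one transposition. *)
Lemma perm_extension (D : {set T}) (p : T -> T) :
  {in D &, injective p} -> exists s : {perm T}, {in D, s =1 p}.
Proof.
elim: {D}_.+1 {-2}D (ltnSn #|D|) => // m IHm D; rewrite ltnS => leDm injp.
have [->|[k kD]] := set_0Vmem D; first by exists 1 => k; rewrite inE.
have [||s sE] := IHm (D :\ k).
- by apply: leq_trans leDm; rewrite [X in (_ < X)%N](cardsD1 k) kD.
- by move=> a b /setD1P[_ aD] /setD1P[_ bD]; apply: injp.
exists (s * tperm (s k) (p k)) => l lD; rewrite permM.
have [->|lk] := eqVneq l k; first by rewrite tpermL.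
have slE : s l = p l by apply: sE; rewrite !inE lk.
rewrite tpermD ?slE //; last by apply/eqP => /injp kl; rewrite kl ?eqxx in lk.
by rewrite -slE (inj_eq perm_inj) eq_sym.
Qed.

End PermExtension.

Section WreathAction.
Local Open Scope group_scope.
Variables (G : finGroupType) (n : nat).
Implicit Types (x y z a : wreath G n) (w : G * 'I_n) (i j k : 'I_n).

Lemma wreath_mul1E x y k : (x * y).1 k = x.1 k * y.1 (x.2^-1 k).
Proof. by rewrite ffunE. Qed.

Lemma wreath_mul2E x y k : (x * y).2 k = x.2 (y.2 k).
Proof. by rewrite permM. Qed.

(* The wreath product is the group of permutations of [G * 'I_n] commuting
   with right translations of the first component. *)
Definition wact x w : G * 'I_n := (x.1 (x.2 w.2) * w.1, x.2 w.2).

Lemma wactM x y w : wact (x * y) w = wact x (wact y w).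
Proof. by rewrite /wact /= wreath_mul2E wreath_mul1E permK mulgA. Qed.

Lemma wact1 w : wact 1 w = w.
Proof. by case: w => g k; rewrite /wact /= ffunE perm1 mul1g. Qed.

Lemma wactK x : cancel (wact x) (wact x^-1).
Proof. by move=> w; rewrite -wactM mulVg wact1. Qed.

Lemma wactKV x : cancel (wact x^-1) (wact x).
Proof. by move=> w; rewrite -wactM mulgV wact1. Qed.

Lemma wact_inj x : injective (wact x).
Proof. exact: can_inj (wactK x). Qed.

Definition rshiftw w (h : G) : G * 'I_n := (w.1 * h, w.2).

Lemma wact_rshiftw x w h : wact x (rshiftw w h) = rshiftw (wact x w) h.
Proof. by rewrite /wact /rshiftw /= mulgA. Qed.

Lemma rshiftw_inj h : injective (rshiftw^~ h).
Proof. by move=> [g k] [g' k'] [/mulIg-> ->]. Qed.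

Lemma wactE x w : wact x w = rshiftw (wact x (1, w.2)) w.1.
Proof. by rewrite -wact_rshiftw /rshiftw /= mul1g; case: w. Qed.

Lemma wreath_ext x y : (forall k, wact x (1, k) = wact y (1, k)) -> x = y.
Proof.
move=> eq_xy.
have eq2 : x.2 = y.2 by apply/permP => k; case: (eq_xy k).
case: x y eq_xy eq2 => [g s] [h t] /= eq_xy eq2; congr (_, _) => //.
apply/ffunP => k; case: (eq_xy (s^-1 k)) => /=.
by rewrite -eq2 !permKV !mulg1.
Qed.

Lemma iter_wact2 x m w : (iter m (wact x) w).2 = iter m x.2 w.2.
Proof. by elim: m => //= m ->. Qed.

(** All conjugating elements below come from here. By right equivariance the images of the points
    [(1, k)] may be chosen freely, as long as their positions stay distinct. *)
Lemma wact_extension (D : {set 'I_n}) (phi : 'I_n -> G * 'I_n) :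
  {in D &, injective (fun k => (phi k).2)} ->
  exists a, {in D, forall k, wact a (1, k) = phi k}.
Proof.
case/perm_extension => s sE.
exists ([ffun k => (phi (s^-1 k)).1], s) => k kD.
by rewrite /wact /= ffunE permK mulg1 sE //; case: (phi k).
Qed.

Definition supp x : {set 'I_n} := [set k | wact x (1, k) != (1, k)].

Lemma suppP x k w : w.2 = k -> reflect (wact x w = w) (k \notin supp x).
Proof.
move=> <-; rewrite inE negbK; apply: (iffP eqP) => [fixk|fixw].
  by rewrite wactE fixk /rshiftw /= mul1g; case: (w).
apply: (@rshiftw_inj w.1); rewrite -wactE fixw /rshiftw /= mul1g.
by case: (w).
Qed.

Lemma wact_supp x w : w.2 \notin supp x -> wact x w = w.
Proof. by move/suppP; apply. Qed.

Lemma suppM x y : supp (x * y) \subset supp x :|: supp y.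
Proof.
apply/subsetP => k; rewrite !in_setU; apply: contraLR.
rewrite negb_or => /andP[kx ky]; apply/(@suppP _ _ (1, k)) => //.
by rewrite wactM !wact_supp.
Qed.

Lemma suppJ x y k : (k \in supp (x ^ y)) = (y.2 k \in supp x).
Proof.
have fixE : (wact (x ^ y) (1, k) == (1, k)) = (wact x (wact y (1, k)) == wact y (1, k)).
  by rewrite conjgE !wactM -(inj_eq (@wact_inj y)) wactKV.
rewrite [LHS]inE fixE; apply: negb_inj; rewrite negbK.
apply/eqP/idP => [fixk|]; last exact: (@wact_supp x (wact y (1, k))).
by apply/(@suppP x _ (wact y (1, k))).
Qed.

Lemma card_suppJ x y : #|supp (x ^ y)| = #|supp x|.
Proof.
rewrite -(card_preimset (supp x) (@perm_inj _ y.2)).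
by apply: eq_card => k; rewrite suppJ [RHS]inE.
Qed.

Lemma supp0 x : supp x = set0 -> x = 1.
Proof.
move=> x0; apply: wreath_ext => k; rewrite wact1.
by apply: wact_supp; rewrite x0 inE.
Qed.

Lemma supp_stable x (D : {set 'I_n}) k :
  supp x \subset D -> k \in D -> x.2 k \in D.
Proof.
move=> sxD kD; apply: contraLR (kD) => xkD.
have /wact_inj fixk : wact x (wact x (1, k)) = wact x (1, k).
  by apply: wact_supp; apply: contra xkD; apply: (subsetP sxD).
by rewrite -[k]/((1%g : G, k).2) -fixk.
Qed.

(** Outside [D] there is nothing to check: [z] fixes the point, and [x] fixes its image under [a],
    which lies outside [a.2 @: D]. *)
Lemma conj_on x a z (D : {set 'I_n}) :
    supp z \subset D -> supp x \subset a.2 @: D ->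
    {in D, forall k, wact x (wact a (1, k)) = wact a (wact z (1, k))} ->
  z = x ^ a.
Proof.
move=> szD sxD eqD; apply: (canRL (mulKg _)); symmetry.
apply: wreath_ext => k; rewrite !wactM; case: (boolP (k \in D)) => [/eqD//|kD].
rewrite (@wact_supp z) ?(@wact_supp x) //=; last exact: contra (subsetP szD _) _.
apply: contra kD => akx; have := subsetP sxD _ akx.
by case/imsetP=> l lD /perm_inj->.
Qed.

(* Two commuting elements with disjoint supports may be conjugated
   independently as long as the supports remain disjoint. *)
Lemma conj_disjoint x1 x2 a1 a2 :
    [disjoint supp x1 & supp x2] ->
    [disjoint supp (x1 ^ a1) & supp (x2 ^ a2)] ->
  x1 ^ a1 * x2 ^ a2 \in (x1 * x2) ^: [set: wreath G n].
Proof.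
set z1 := x1 ^ a1; set z2 := x2 ^ a2 => dx dz.
have xa1 w : wact x1 (wact a1 w) = wact a1 (wact z1 w).
  by rewrite -!wactM /z1 conjgE mulKVg.
have xa2 w : wact x2 (wact a2 w) = wact a2 (wact z2 w).
  by rewrite -!wactM /z2 conjgE mulKVg.
(* The common conjugator follows [a1] on [supp z1] and [a2] on [supp z2]. The images lie in
   [supp x1] and [supp x2], which are disjoint, so [phi] is injective on positions. *)
pose phi k := if k \in supp z1 then wact a1 (1, k) else wact a2 (1, k).
have nz21 k : k \in supp z2 -> (k \in supp z1) = false.
  by move=> k2; rewrite (disjointFl dz).
have [|a aE] := @wact_extension (supp z1 :|: supp z2) phi.
  have sep k l : k \in supp z1 -> l \in supp z2 -> a1.2 k <> a2.2 l.
    rewrite !suppJ => k1 l2 kl; rewrite -kl in l2.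
    by rewrite (disjointFr dx k1) in l2.
  move=> k l; rewrite !in_setU /phi => /orP[k1|k2] /orP[l1|l2];
    rewrite ?l1 ?k1 ?nz21 //=.
  - exact: perm_inj.
  - by move/sep; case.
  - by move/esym/sep; case.
  - exact: perm_inj.
have a1E w : w.2 \in supp z1 -> wact a w = wact a1 w.
  move=> w1; rewrite wactE [RHS]wactE aE /phi ?w1 // inE w1 //.
have a2E w : w.2 \in supp z2 -> wact a w = wact a2 w.
  move=> w2; rewrite wactE [RHS]wactE aE /phi ?nz21 // inE w2 orbT //.
have ax1 k : k \in supp z1 -> a.2 k = a1.2 k.
  by move=> k1; have [] := a1E (1, k) k1.
have ax2 k : k \in supp z2 -> a.2 k = a2.2 k.
  by move=> k1; have [] := a2E (1, k) k1.
apply/imsetP; exists a => //; apply: conj_on (suppM _ _) _ _.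
  apply/subsetP => k /(subsetP (suppM _ _)); rewrite in_setU => /orP[] kx.
    have k1 : a1.2^-1 k \in supp z1 by rewrite suppJ permKV.
    by apply/imsetP; exists (a1.2^-1 k); rewrite ?in_setU ?k1 ?ax1 ?permKV.
  have k2 : a2.2^-1 k \in supp z2 by rewrite suppJ permKV.
  apply/imsetP; exists (a2.2^-1 k); last by rewrite ax2 ?permKV.
  by rewrite in_setU k2 orbT.
move=> k; rewrite in_setU => /orP[] kz.
  have zk : z1.2 k \in supp z1 by apply: supp_stable kz.
  have x2k : a1.2 k \notin supp x2 by move: kz; rewrite suppJ => /(disjointFr dx)->.
  have z2k : k \notin supp z2 by rewrite (disjointFr dz kz).
  by rewrite a1E // (wactM x1) (wactM z1) (@wact_supp x2 (wact a1 (1, k)) x2k) (@wact_supp z2 (1, k) z2k) xa1 a1E.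
have zk : z2.2 k \in supp z2 by apply: supp_stable kz.
have x1k : (wact a2 (wact z2 (1, k))).2 \notin supp x1.
  by move: zk; rewrite suppJ => /(disjointFl dx)->.
have z1k : (wact z2 (1, k)).2 \notin supp z1 by rewrite nz21.
by rewrite a2E // (wactM x1) (wactM z1) xa2 (wact_supp x1k) (wact_supp z1k) a2E.
Qed.

(** The factors are the restrictions of [x] to [O] and to its complement, each extended by the
    identity. *)
Lemma supp_split x (O : {set 'I_n}) :
    (forall k, (x.2 k \in O) = (k \in O)) ->
  exists x1 x2, [/\ x = x1 * x2, supp x1 = supp x :&: O
                  & supp x2 = supp x :\: O].
Proof.
move=> stO.
have restr (D : {set 'I_n}) : (forall k, (x.2 k \in D) = (k \in D)) ->
    exists y, forall k, wact y (1, k) = if k \in D then wact x (1, k) else (1, k).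
  move=> stD; pose phi k := if k \in D then wact x (1, k) else (1%g : G, k).
  have [|y yE] := @wact_extension [set: 'I_n] phi.
    move=> k l _ _; rewrite /phi; case: ifP => kD; case: ifP => lD //=.
    - exact: perm_inj.
    - by move=> kl; rewrite -kl stD kD in lD.
    - by move=> kl; rewrite kl stD lD in kD.
  by exists y => k; rewrite yE ?inE.
have [x1 x1E] := restr O stO.
have [|x2 x2E] := restr (~: O); first by move=> k; rewrite !inE stO.
exists x1, x2; split; last 2 first.
- by apply/setP => k; rewrite !inE x1E; case: ifP; rewrite ?andbT ?andbF ?eqxx.
- by apply/setP => k; rewrite !inE x2E inE; case: (k \in O); rewrite //= eqxx.
apply: wreath_ext => k; rewrite wactM x2E inE; case: (boolP (k \in O)) => kO /=.
  by rewrite x1E kO.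
by rewrite [RHS]wactE x1E /= stO (negPf kO) /rshiftw /= mul1g.
Qed.

End WreathAction.

(** * Cycles and generation of the class algebra *)

Section Cycles.
Local Open Scope group_scope.
Variables (G : finGroupType) (n : nat).
Implicit Types (x y z a : wreath G n) (i j k : 'I_n).

(* For [i] in the support of a cycle [x] this is the conjugacy class of the
   cycle product: going once around the cycle moves [(1, i)] to [(color x i, i)]. *)
Definition color x i : G := (iter #|porbit x.2 i| (wact x) (1, i)).1.

Lemma iter_wact_porbit x i :
  iter #|porbit x.2 i| (wact x) (1, i) = (color x i, i).
Proof.
by rewrite [LHS]surjective_pairing iter_wact2 iter_porbit.
Qed.

Lemma iter_wact_rshiftw x m w h :
  iter m (wact x) (rshiftw w h) = rshiftw (iter m (wact x) w) h.
Proof. by elim: m => //= m ->; rewrite wact_rshiftw. Qed.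

Lemma mem_porbit_iter (s : 'S_n) i m : iter m s i \in porbit s i.
Proof. by rewrite -permX mem_porbit. Qed.

Lemma porbit_index (s : 'S_n) i l : l \in porbit s i ->
  exists2 m, (m < #|porbit s i|)%N & l = iter m s i.
Proof. by rewrite porbit_traject => /trajectP. Qed.

Lemma index_porbit (s : 'S_n) i m : (m < #|porbit s i|)%N ->
  index (iter m s i) (traject s i #|porbit s i|) = m.
Proof.
move=> ltm; rewrite -(nth_traject s ltm) index_uniq ?size_traject //.
exact: uniq_traject_porbit.
Qed.

(** Match the walk of [z] from [(1, j)] with the walk of [x] from [(h, i)], step by step. The
    relation between the colors says that the two walks still match after a full turn. *)
Lemma cycle_conj x z i j h :
    supp x = porbit x.2 i -> supp z = porbit z.2 j ->
    #|supp x| = #|supp z| -> color z j = color x i ^ h ->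
  z \in x ^: [set: wreath G n].
Proof.
move=> xi zj eqr colz.
have rxz : #|porbit x.2 i| = #|porbit z.2 j| by rewrite -xi -zj.
pose r := #|porbit z.2 j|.
have r0 : (0 < r)%N by rewrite card_gt0; apply/set0Pn; exists j; apply: porbit_id.
pose idx l := index l (traject z.2 j r).
(* The conjugator is prescribed at [(1, l)], so the label that the walk of [z] has collected on
   reaching [l] is divided out. *)
pose phi l := rshiftw (iter (idx l) (wact x) (h, i))
                      (iter (idx l) (wact z) (1, j)).1^-1.
have [|a aE] := @wact_extension _ _ (supp z) phi.
  move=> l l'; rewrite zj => /porbit_index[m ltm ->] /porbit_index[m' ltm' ->].
  rewrite /phi /idx !index_porbit //= !iter_wact2 /= => eqm.
  rewrite -rxz in ltm ltm'.
  by rewrite -[m](@index_porbit x.2 i) // eqm index_porbit.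
have aE0 : wact a (1, j) = (h, i).
  rewrite aE ?zj ?porbit_id // /phi /idx (@index_porbit z.2 j 0) //.
  by rewrite /rshiftw /= invg1 mulg1.
(* The case [m = r] closes the cycle; this is where the colors enter. *)
have aiter m : (m <= r)%N ->
    wact a (iter m (wact z) (1, j)) = iter m (wact x) (h, i).
  rewrite leq_eqVlt => /predU1P[->|ltm].
    rewrite /r iter_wact_porbit wactE aE0 -rxz.
    have -> : (h, i) = rshiftw (1, i) h by rewrite /rshiftw mul1g.
    by rewrite iter_wact_rshiftw iter_wact_porbit /rshiftw /= mul1g colz -conjgC.
  rewrite wactE iter_wact2 /= aE ?zj ?mem_porbit_iter //.
  rewrite /phi /idx index_porbit //.
  by rewrite /rshiftw /= mulgKV -surjective_pairing.
apply/imsetP; exists a => //; apply: conj_on (subxx _) _ _.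
  apply/subsetP => k; rewrite xi => /porbit_index[m]; rewrite rxz => ltm ->.
  apply/imsetP; exists (iter m z.2 j).
    by rewrite zj porbit_traject; apply/trajectP; exists m.
  by have /(congr1 snd) := aiter m (ltnW ltm); rewrite /= !iter_wact2 /= => <-.
move=> k; rewrite zj => /porbit_index[m ltm ->].
pose g := (iter m (wact z) (1, j)).1.
have -> : (1, iter m z.2 j) = rshiftw (iter m (wact z) (1, j)) g^-1.
  by rewrite /rshiftw mulgV iter_wact2.
rewrite !wact_rshiftw aiter ?(ltnW ltm) //; congr rshiftw.
exact: esym (aiter m.+1 ltm).
Qed.

End Cycles.

(** * Class functions and subalgebras of the group algebra *)

Section ClassFunctions.
Variables (F : numFieldType) (G : finGroupType).
Implicit Types (f g : grpalg F G) (x y z : G).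

Lemma grpalgZE a f x : (a *: f) x = a * f x.
Proof. by rewrite ffunE. Qed.

Definition class_ind x : grpalg F G := [ffun z => (z \in x ^: [set: G])%:R].

Lemma class_indE x z : class_ind x z = (z \in x ^: [set: G])%:R.
Proof. by rewrite ffunE. Qed.

Lemma class_ind_class x : class_algebra (class_ind x).
Proof. by move=> z y; rewrite !class_indE memJ_norm // (subsetP (class_norm _ _)) ?inE. Qed.

Lemma class_ind1 : class_ind 1%g = 1.
Proof.
by apply/ffunP => z; rewrite !ffunE /= class1G ?inE // -[_ \in _]/(z \in [1]) inE.
Qed.

Lemma class_algebra_on_class f x z :
  class_algebra f -> z \in x ^: [set: G] -> f z = f x.
Proof. by move=> clf /imsetP[y _ ->]; apply: clf. Qed.

Lemma class_algebra_linear a f g :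
  class_algebra f -> class_algebra g -> class_algebra (a *: f + g).
Proof. by move=> clf clg x y; rewrite !ffunE clf clg. Qed.

Lemma conv_class f g :
  class_algebra f -> class_algebra g -> class_algebra (f * g).
Proof.
move=> clf clg x y; rewrite !ffunE (reindex_inj (conjg_inj y)) /=.
by apply: eq_bigr => z _; rewrite clf -conjVg -conjMg clg.
Qed.

Lemma class_algebra1 : class_algebra (1 : grpalg F G).
Proof. by move=> x y; rewrite !ffunE /= conjg_eq1. Qed.

Section Generation.
Variable B : {pred grpalg F G}.
Hypothesis algB : GRing.subalg_closed B.

Lemma subalg_lin a f g : f \in B -> g \in B -> a *: f + g \in B.
Proof. by case: algB => _ linB _; apply: linB. Qed.

Lemma subalg0 : 0 \in B.
Proof.
have B1 : 1 \in B by case: algB.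
by have := subalg_lin (-1) B1 B1; rewrite scaleN1r addNr.
Qed.

Lemma subalgZ a f : f \in B -> a *: f \in B.
Proof. by move=> Bf; have := subalg_lin a Bf subalg0; rewrite addr0. Qed.

Lemma subalgD f g : f \in B -> g \in B -> f + g \in B.
Proof. by move=> Bf Bg; have := subalg_lin 1 Bf Bg; rewrite scale1r. Qed.

Lemma subalg_sum (I : finType) (P : pred I) (E : I -> grpalg F G) :
  (forall i, P i -> E i \in B) -> \sum_(i | P i) E i \in B.
Proof.
by move=> BE; apply: (big_ind (fun f => f \in B)) => //; [apply: subalg0 | apply: subalgD].
Qed.

Lemma class_fun_subalg f : class_algebra f ->
  (forall x, f x != 0 -> class_ind x \in B) -> f \in B.
Proof.
move=> clf Bx.
(* The sum runs over elements, not over representatives: each class occurs once per element, whence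
   the division by its size. *)
have -> : f = \sum_(x | f x != 0)
     (f x / #|x ^: [set: G]|%:R) *: class_ind x.
  apply/ffunP => z; rewrite sum_ffunE.
  under eq_bigr do rewrite grpalgZE class_indE.
  rewrite big_mkcond /= (eq_bigr (fun x => if x \in z ^: [set: G]
    then f z / #|z ^: [set: G]|%:R else 0)) => [|x _].
    rewrite -big_mkcond /= sumr_const -(mulr_natr (f z / _)) divfK //.
    by rewrite pnatr_eq0 -lt0n card_gt0; apply/set0Pn; exists z; apply: class_refl.
  have -> : (x \in z ^: [set: G]) = (z \in x ^: [set: G]) by apply: class_sym.
  have [xz|xz] := boolP (z \in x ^: [set: G]).
    have -> : x ^: [set: G] = z ^: [set: G] by apply/esym/class_eqP.
    by rewrite -(class_algebra_on_class clf xz) mulr1; case: eqP => // ->; rewrite mul0r.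
  by rewrite mulr0 if_same.
by apply: subalg_sum => x /Bx; apply: subalgZ.
Qed.

End Generation.
End ClassFunctions.

Section WreathGeneration.
Variables (F : numFieldType) (G : finGroupType) (n : nat).
Implicit Types x y z : wreath G n.
Variable B : {pred grpalg F (wreath G n)}.
Hypothesis algB : GRing.subalg_closed B.
Hypothesis classB : forall b, b \in B -> class_algebra b.

(* By induction on the size of the support: the product of the class sums of
   two disjoint parts of [x] is a multiple of the class sum of [x], up to
   elements of smaller support. *)
Lemma cycles_generate :
    (forall x i, i \in supp x -> supp x = porbit x.2 i ->
       exists2 b, b \in B & forall z, (#|supp x| <= #|supp z|)%N ->
                              b z = class_ind F x z) ->
  forall f, class_algebra f -> f \in B.
Proof.
move=> cycB f clf; apply: (class_fun_subalg algB clf) => x _ {f clf}.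
have [d] := ubnP #|supp x|; elim: d => // d IHd in x *; rewrite ltnS => led.
(* By induction, class functions that vanish on all supports at least as large as [supp x] belong to
   [B]; they are the admissible errors. *)
have lower f : class_algebra f ->
    (forall z, (#|supp x| <= #|supp z|)%N -> f z = 0) -> f \in B.
  move=> clf fz; apply: (class_fun_subalg algB clf) => z fz0.
  apply: IHd; apply: leq_trans led; rewrite ltnNge.
  by apply: contra fz0 => /fz->.
have [/supp0->|[i ix]] := set_0Vmem (supp x).
  by rewrite class_ind1; case: algB.
have [xi|xi] := eqVneq (supp x) (porbit x.2 i).
  have [b Bb bE] := cycB x i ix xi.
  rewrite -[class_ind F x](subrK b) addrC; apply: subalgD => //.
  apply: lower => [|z xz]; last by rewrite !ffunE bE // class_indE subrr.
  rewrite addrC -scaleN1r; apply: class_algebra_linear; first exact: classB.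
  exact: class_ind_class.
have stO k : (x.2 k \in porbit x.2 i) = (k \in porbit x.2 i).
  by rewrite -!eq_porbit_mem -[x.2 k]/((x.2 ^+ 1)%g k) porbit_perm.
have sOx : porbit x.2 i \subset supp x.
  apply/subsetP => k /porbitP[m ->]; rewrite permX.
  elim: m => //= m; apply: supp_stable.
  exact: subxx.
have [x1 [x2 [xE x1E x2E]]] := supp_split stO.
have {}x1E : supp x1 = porbit x.2 i by rewrite x1E (setIidPr sOx).
have dx12 : [disjoint supp x1 & supp x2].
  by rewrite x1E x2E -setI_eq0 setIDA setIC -setIDA setDv setI0.
have cardx : (#|supp x| = #|supp x1| + #|supp x2|)%N.
  by rewrite -(cardsID (porbit x.2 i) (supp x)) (setIidPr sOx) x1E x2E.
have x10 : (0 < #|supp x1|)%N.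
  by rewrite card_gt0 x1E; apply/set0Pn; exists i; apply: porbit_id.
have x20 : (0 < #|supp x2|)%N.
  by rewrite card_gt0 x2E setD_eq0; apply: contra xi => sxO; rewrite eqEsubset sxO.
have Bx1 : class_ind F x1 \in B.
  by apply: IHd; apply: leq_trans led; rewrite cardx -addn1 leq_add2l.
have Bx2 : class_ind F x2 \in B.
  by apply: IHd; apply: leq_trans led; rewrite cardx -add1n leq_add2r.
pose p := class_ind F x1 * class_ind F x2.
have Bp : p \in B by case: algB => _ _ mulB; apply: mulB.
(* The factorization [x = x1 * x2] contributes 1 to the convolution, and all other terms are
   nonnegative. *)
have px0 : p x != 0.
  rewrite ffunE (bigD1 x1) //= !class_indE xE mulKg !class_refl mulr1.
  apply: lt0r_neq0; apply: ltr_pwDl => //; apply: sumr_ge0 => y _.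
  by rewrite !class_indE -natrM ler0n.
rewrite -[class_ind F x](scalerK px0); apply: subalgZ => //.
rewrite -[_ *: _](subrK p); apply: subalgD => //.
apply: lower => [|z xz].
  apply: class_algebra_linear; first exact: class_ind_class.
  by rewrite -scaleN1r -[_ *: _]addr0; apply: class_algebra_linear (classB Bp) _ => // ? ?; rewrite !ffunE.
rewrite ffunE grpalgZE class_indE [(- p) z]ffunE.
have [zx|zx] := boolP (z \in _).
  by rewrite (class_algebra_on_class (classB Bp) zx) mulr1 subrr.
rewrite mulr0 sub0r ffunE big1 ?oppr0 // => y _; rewrite !class_indE -natrM mulnb.
case: andP => // -[/imsetP[a1 _ yE] /imsetP[a2 _ yzE]]; case/negP: zx.
have zE : z = (x1 ^ a1 * x2 ^ a2)%g by rewrite -yE -yzE mulKVg.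
rewrite zE xE; apply: conj_disjoint => //.
(* The support of [z] lies in the union of two supports whose sizes add up to [#|supp x|]; being at
   least that large, it forces them to be disjoint. *)
rewrite -setI_eq0 -cards_eq0 -leqn0 -(leq_add2l #|supp (x1 ^ a1)%g :|: supp (x2 ^ a2)%g|).
rewrite cardsUI addn0 !card_suppJ -cardx; apply: leq_trans xz _.
by rewrite zE; apply: subset_leq_card; apply: suppM.
Qed.

End WreathGeneration.

(** * The family P *)

Lemma imset_porbit (T T' : finType) (f : T -> T') (s : {perm T}) (t : {perm T'}) l :
  (forall i, f (s i) = t (f i)) -> f @: porbit s l = porbit t (f l).
Proof.
move=> fst; have fX m : f ((s ^+ m)%g l) = (t ^+ m)%g (f l).
  by rewrite !permX; elim: m => //= m <-.
apply/setP => k; apply/imsetP/porbitP => [[j /porbitP[m ->] ->]|[m ->]].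
  by exists m.
by exists ((s ^+ m)%g l); rewrite ?mem_porbit.
Qed.

Section Colors.
Local Open Scope group_scope.
Variables (G : finGroupType) (n : nat).
Implicit Types (x y z a : wreath G n) (i j k : 'I_n).

Lemma porbitJ x y j : y.2 @: porbit (x ^ y).2 j = porbit x.2 (y.2 j).
Proof.
apply: imset_porbit => i.
by rewrite -!wreath_mul2E conjgE mulKVg.
Qed.

(** The action of [y] carries the walk of [x ^ y] from [(1, j)] to the walk of [x] from the image of
    [(1, j)]; the label of that image is the conjugator. *)
Lemma colorJ x y j : color (x ^ y) j = color x (y.2 j) ^ y.1 (y.2 j).
Proof.
have r : #|porbit (x ^ y).2 j| = #|porbit x.2 (y.2 j)|.
  by rewrite -porbitJ card_imset //; apply: perm_inj.
have it m w : wact y (iter m (wact (x ^ y)) w) = iter m (wact x) (wact y w).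
  by elim: m => //= m <-; rewrite -!wactM conjgE mulKVg.
have := it #|porbit (x ^ y).2 j| (1, j); rewrite iter_wact_porbit r.
have -> : wact y (1, j) = rshiftw (1, y.2 j) (y.1 (y.2 j)).
  by rewrite /wact /rshiftw /= mulg1 mul1g.
rewrite iter_wact_rshiftw iter_wact_porbit => -[/= eqc].
by rewrite [RHS]conjgE -eqc mulKg.
Qed.

(** Conjugating [x] by itself changes nothing, but in [colorJ] it moves the base point one step
    along the cycle. *)
Lemma color_porbit (T : Type) (f : G -> T) x i j :
  (forall g h, f (g ^ h) = f g) -> j \in porbit x.2 i ->
  f (color x j) = f (color x i).
Proof.
move=> clf /porbit_index[m _ ->]; have xx : x ^ x = x by rewrite conjgE mulKg.
elim: m => //= m <-.
by rewrite -(clf _ (x.1 (x.2 (iter m x.2 i)))) -colorJ xx.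
Qed.

End Colors.

(** * Families concentrated on cycles *)

Section CycleLike.
Variables (F : numFieldType) (G : finGroupType).

(* [f alpha] is concentrated on cycles of length [k.+1], with values
   proportional to [alpha] of the cycle product, up to elements of support of
   size at most [k]. *)
Definition cycle_like n k (f : grpalg F G -> grpalg F (wreath G n)) : Prop :=
  [/\ forall a u v, f (a *: u + v) = a *: f u + f v,
      forall alpha, class_algebra alpha -> class_algebra (f alpha),
      forall alpha x, class_algebra alpha -> (k < #|supp x|)%N ->
        f alpha x != 0 ->
        #|supp x| = k.+1 /\ exists2 i, i \in supp x & supp x = porbit x.2 i
    & forall x i, i \in supp x -> supp x = porbit x.2 i -> #|supp x| = k.+1 ->
        exists2 c, c != 0 &
          forall alpha, class_algebra alpha -> f alpha x = c * alpha (color x i)].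

(** Apply the member of index [#|supp x| - 1] to the indicator of the class of the color of the
    cycle [x]. By [cycle_conj] the result is, up to smaller support, a multiple of the class sum of
    [x]. *)
Lemma cycle_like_generate n (fam : 'I_n -> grpalg F G -> grpalg F (wreath G n))
    (B : {pred grpalg F (wreath G n)}) :
    GRing.subalg_closed B -> (forall b, b \in B -> class_algebra b) ->
    (forall i : 'I_n, cycle_like i (fam i)) ->
    (forall i alpha, class_algebra alpha -> fam i alpha \in B) ->
  forall f, class_algebra f -> f \in B.
Proof.
move=> algB classB famP famB; apply: cycles_generate => // x i ix xi.
have ltkn : (#|supp x|.-1 < n)%N.
  rewrite prednK; first by rewrite -[n in (_ <= n)%N]card_ord max_card.
  by rewrite card_gt0; apply/set0Pn; exists i.
pose k := Ordinal ltkn.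
have kE : #|supp x| = k.+1.
  by rewrite /= prednK // card_gt0; apply/set0Pn; exists i.
have [_ clf f_cyc f_col] := famP k.
have [c c0 cE] := f_col x i ix xi kE.
have clc := class_ind_class F (color x i).
exists (c^-1 *: fam k (class_ind F (color x i))).
  by apply: (subalgZ algB); apply: famB.
move=> z xz; rewrite grpalgZE class_indE.
have [zx|zx] := boolP (z \in _).
  rewrite (class_algebra_on_class (clf _ clc) zx) cE // class_indE class_refl.
  by rewrite mulr1 mulVf.
apply/eqP; rewrite mulf_eq0; apply/orP; right; apply/negPn/negP => fz0.
have ltkz : (k < #|supp z|)%N by rewrite -kE.
have [zE [j jz zj]] := f_cyc _ _ clc ltkz fz0.
have [c' _ c'E] := f_col z j jz zj zE.
move: fz0; rewrite c'E // class_indE; case: imsetP => [[h _ colz] _|]; last first.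
  by rewrite mulr0 eqxx.
by case/negP: zx; apply: (cycle_conj (i := i) (j := j) (h := h)); rewrite ?kE ?zE.
Qed.

Lemma cycle_like_scale n k c (f : grpalg F G -> grpalg F (wreath G n)) :
  c != 0 -> cycle_like k f -> cycle_like k (fun alpha => c *: f alpha).
Proof.
move=> c0 [linf clf f_cyc f_col]; split.
- by move=> a u v; rewrite linf scalerDr !scalerA mulrC.
- by move=> alpha /clf cl x y; rewrite !grpalgZE cl.
- move=> alpha x cl kx; rewrite grpalgZE mulf_eq0 negb_or => /andP[_].
  exact: f_cyc.
move=> x i ix xi xk; have [c' c'0 c'E] := f_col x i ix xi xk.
exists (c * c'); first by rewrite mulf_neq0.
by move=> alpha cl; rewrite grpalgZE c'E ?mulrA.
Qed.

Lemma cycle_like_cast n m k (e : n = m)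
    (f : grpalg F G -> grpalg F (wreath G n)) :
  cycle_like k f ->
  cycle_like k (fun alpha => ecast N (grpalg F (wreath G N)) e (f alpha)).
Proof. by case: m / e. Qed.

End CycleLike.

(** * Block sums *)

Section WreathSum.
Variables (G : finGroupType) (r m : nat).
Implicit Types (h : wreath G r) (v : wreath G m).
Local Notation embw := (fun w : G * 'I_r => (w.1, lshift m w.2)).

Lemma split_lshift (l : 'I_r) : split (lshift m l) = inl l.
Proof. exact: (unsplitK (inl l)). Qed.

Lemma split_rshift (l : 'I_m) : split (rshift r l) = inr l.
Proof. exact: (unsplitK (inr l)). Qed.

Lemma perm_sum_lshift h v l : 
  (wreath_sum (h, v)).2 (lshift m l) = lshift m (h.2 l).
Proof. by rewrite permE /perm_sum_fun split_lshift. Qed.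

Lemma wact_sum_lshift h v w :
  wact (wreath_sum (h, v)) (embw w) = embw (wact h w).
Proof.
by case: w => g l; rewrite /wact perm_sum_lshift /= ffunE split_lshift.
Qed.

Lemma wact_sum1_rshift h g (l : 'I_m) :
  wact (wreath_sum (h, 1%g)) (g, rshift r l) = (g, rshift r l).
Proof.
rewrite /wact /= permE /perm_sum_fun split_rshift /= ffunE perm1.
by rewrite split_rshift /= ffunE mul1g.
Qed.

Lemma supp_sum1 h : supp (wreath_sum (h, 1%g)) \subset [set lshift m l | l : 'I_r].
Proof.
apply/subsetP => k; rewrite -[k]splitK; case: (split k) => l /=.
  by move=> _; apply/imsetP; exists l.
by rewrite inE wact_sum1_rshift eqxx.
Qed.

Lemma porbit_sum_lshift h v l :
  porbit (wreath_sum (h, v)).2 (lshift m l) = lshift m @: porbit h.2 l.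
Proof. by apply/esym/imset_porbit => i; rewrite perm_sum_lshift. Qed.

Lemma color_sum_lshift h v l :
  color (wreath_sum (h, v)) (lshift m l) = color h l.
Proof.
rewrite /color porbit_sum_lshift card_imset; last exact: lshift_inj.
have it N w : iter N (wact (wreath_sum (h, v))) (embw w) =
    embw (iter N (wact h) w).
  by elim: N => //= N ->; apply: wact_sum_lshift.
by rewrite (it _ (1%g, l)).
Qed.

Lemma wreath_sum1_surj (z : wreath G (r + m)) :
  supp z \subset [set lshift m l | l : 'I_r] ->
  exists h, z = wreath_sum (h, 1%g).
Proof.
move=> sz.
have stz l : {l' | z.2 (lshift m l) == lshift m l'}.
  apply: sigW; have : z.2 (lshift m l) \in [set lshift m l | l : 'I_r].
    by apply: (supp_stable sz); apply: imset_f.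
  by case/imsetP=> l' _ ->; exists l'.
have [|h hE] := @wact_extension G r [set: 'I_r]
    (fun l => ((wact z (1%g, lshift m l)).1, sval (stz l))).
  move=> l l' _ _ /= eql; apply: (@lshift_inj r m); apply: (@perm_inj _ z.2).
  by rewrite (eqP (svalP (stz l))) (eqP (svalP (stz l'))) eql.
exists h; apply: wreath_ext => k; rewrite -[k]splitK; case: (split k) => l /=.
  by rewrite (wact_sum_lshift h 1%g (1%g, l)) hE ?inE //= -(eqP (svalP (stz l))).
rewrite wact_sum1_rshift; apply: wact_supp; apply: contra (subsetP sz _) _.
by apply/imsetP => -[l' _ /= /eqP]; rewrite eq_rlshift.
Qed.

End WreathSum.

(** A walk collects the label of the point at which it arrives, so the walk whose first label is
    that of [i] starts one step before [i]. *)
Lemma cycle_prodE (G : finGroupType) n (x : wreath G n) r i :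
  cycle_prod x r i = (iter r (wact x) (1, x.2^-1 i)%g).1.
Proof.
elim: r => [|r IHr]; rewrite /cycle_prod ?big_ord0 // big_ord_recl /= subSS subn0.
by rewrite -IHr iter_wact2 -iterS iterSr permKV.
Qed.

Section Creation.
Variables (F : numFieldType) (G : finGroupType).

Lemma induced_class (H K : finGroupType) (phi : H -> K) (f : grpalg F H) :
  class_algebra (induced phi f).
Proof.
move=> x y; rewrite !ffunE; congr (_ * _).
rewrite [RHS](reindex_inj (mulgI y)) /=.
by apply: eq_bigr => z _; rewrite conjgM.
Qed.

Lemma sigmaE r (alpha : grpalg F G) (h : wreath G r.+1) : sigma r alpha h =
  ((porbit h.2 ord0 == [set: 'I_r.+1])%:R * r.+1%:R) * alpha (color h (h.2^-1 ord0)%g).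
Proof.
rewrite ffunE; case: eqP => [full|_]; last by rewrite !mul0r.
rewrite mul1r cycle_prodE /color; suff -> : #|porbit h.2 (h.2^-1 ord0)%g| = r.+1 by [].
suff -> : porbit h.2 (h.2^-1 ord0)%g = porbit h.2 ord0 by rewrite full cardsT card_ord.
by apply/eqP; rewrite eq_porbit_mem full inE.
Qed.

(** On one point [sigma 0 1] is the indicator of the identity. Inducing a multiple of the unit again
    gives one, since the identity is alone in its class. *)
Lemma vacuum_powerE m : exists2 c : F, c != 0 & vacuum_power F G m = c *: 1.
Proof.
elim: m => [|m [c c0 /= ->]]; first by exists 1; rewrite ?oner_eq0 ?scale1r.
(* The normalization of the induction, times the number of conjugators (all of them count at the
   identity), times the previous constant. *)
exists (#|{: wreath G 1 * wreath G m}|%:R^-1 * #|{: wreath G m.+1}|%:R * c).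
  rewrite !mulf_neq0 ?invr_eq0 ?pnatr_eq0 -?lt0n //.
    by rewrite lt0n; apply/pred0Pn; exists (1%g, 1%g).
  by apply/card_gt0P; exists 1%g.
have tensorE h : tensor (sigma 0 (1 : grpalg F G)) (c *: 1 : grpalg F (wreath G m)) h =
    c * (h == 1%g)%:R.
  rewrite ffunE grpalgZE !ffunE (_ : _ == _); last first.
    by apply/eqP/setP => k; rewrite inE (ord1 k) porbit_id.
  rewrite mul1r cycle_prodE mulrCA -natrM mulnb; congr (_ * (nat_of_bool _)%:R).
  case: h => h1 h2; rewrite -pair_eqE /=; congr (_ && _).
  apply/eqP/eqP => /= [h11|->]; last by rewrite ffunE mul1g.
  rewrite permKV mulg1 in h11; apply: wreath_ext => k.
  by rewrite wact1 /wact /= (ord1 (h1.2 k)) h11 mul1g (ord1 k).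
apply/ffunP => x; rewrite [RHS]grpalgZE [LHS]ffunE -!mulrA; congr (_ * _).
under eq_bigr do under eq_bigr do rewrite tensorE.
have sum1 : wreath_sum (1%g : wreath G 1 * wreath G m) = 1%g.
  by apply: (mulgI (wreath_sum (1%g : wreath G 1 * wreath G m))); rewrite -wreath_sumM !mulg1.
rewrite (eq_bigr (fun=> c * (x == 1%g)%:R)) => [|y _].
  by rewrite sumr_const [(1 : grpalg F _) x]ffunE [RHS]mulr_natl.
rewrite big_mkcond (bigD1 1%g) //= eqxx mulr1 sum1 big1 ?addr0 => [|h h1].
  by rewrite eq_sym conjg_eq1; case: eqP => _; rewrite ?mulr1 ?mulr0.
by rewrite (negPf h1) mulr0 if_same.
Qed.

(** As the vacuum power is a multiple of the unit, the value at [x] only involves conjugates of [x]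
    that are a full cycle on the first block and the identity on the second; [wt] records this
    condition together with the factor [r.+1] of [sigma]. *)
Lemma creation_cycle_like r m :
  cycle_like r (fun alpha : grpalg F G => creation r alpha (vacuum_power F G m)).
Proof.
have [c c0 vacE] := vacuum_powerE m.
pose N : F := #|{: wreath G r.+1 * wreath G m}|%:R.
pose wt (h : wreath G r.+1 * wreath G m) : nat :=
  ((porbit h.1.2 ord0 == [set: 'I_r.+1]) && (h.2 == 1%g) * r.+1)%N.
have crE alpha x : creation r alpha (vacuum_power F G m) x =
   N^-1 * c * \sum_y \sum_(h | wreath_sum h == (x ^ y)%g)
     (wt h)%:R * alpha (color h.1 (h.1.2^-1 ord0)%g).
  rewrite ffunE -mulrA; congr (_ * _); rewrite mulr_sumr.
  apply: eq_bigr => y _; rewrite mulr_sumr; apply: eq_bigr => h _.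
  rewrite ffunE vacE sigmaE grpalgZE ffunE /wt -mulnb -[in RHS]mulnA natrM natrM.
  ring.
have wtP x y h : (r < #|supp x|)%N -> wreath_sum h = (x ^ y)%g -> wt h != 0 ->
    [/\ #|supp x| = r.+1, h.2 = 1%g, porbit h.1.2 ord0 = [set: 'I_r.+1]
      & supp (x ^ y)%g = porbit (x ^ y)%g.2 (lshift m ord0)].
  case: h => h1 h2 rx hE wt0.
  have /andP[/eqP full /eqP h21] :
      (porbit h1.2 ord0 == [set: 'I_r.+1]) && (h2 == 1%g).
    by move: wt0; rewrite /wt muln_eq0 orbF eqb0 negbK.
  rewrite {wt0}h21 in hE *.
  have cardL : #|[set lshift m l | l : 'I_r.+1]| = r.+1.
    by rewrite card_imset ?cardsT ?card_ord //; apply: lshift_inj.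
  have sL := supp_sum1 m h1; rewrite hE in sL.
  (* The support lies in the first block and has more than [r] points, so it fills the block. *)
  have sLE : supp (x ^ y)%g = [set lshift m l | l : 'I_r.+1].
    by apply/eqP; rewrite eqEcard sL cardL card_suppJ.
  split => //; first by rewrite -(card_suppJ x y) sLE.
  by rewrite sLE -hE porbit_sum_lshift full; apply/setP => k; apply/imsetP/imsetP => -[l _ ->]; exists l.
split.
- move=> a u v; apply/ffunP => x; rewrite [RHS]ffunE grpalgZE !crE.
  rewrite mulrCA -mulrDr; congr (_ * _); rewrite mulr_sumr -big_split /=.
  apply: eq_bigr => y _; rewrite mulr_sumr -big_split /=.
  apply: eq_bigr => h _; rewrite [in LHS]ffunE grpalgZE; ring.
- by move=> alpha _; apply: induced_class.
- move=> alpha x cl rx; rewrite crE mulf_eq0 negb_or => /andP[_].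
  have [y|none] := pickP (fun y => [exists h, (wreath_sum h == x ^ y)%g && (wt h != 0)]).
    case/existsP=> h /andP[/eqP hE wt0] _; have [-> _ _ xyE] := wtP x y h rx hE wt0.
    split=> //; exists (y.2 (lshift m ord0)).
      by rewrite -suppJ xyE porbit_id.
    rewrite -porbitJ -xyE; apply/setP => k; apply/idP/imsetP => [kx|[l + ->]].
      by exists (y.2^-1 k)%g; rewrite ?suppJ permKV.
    by rewrite suppJ.
  rewrite big1 ?eqxx // => y _; apply: big1 => h hE.
  have /existsPn/(_ h) := negbT (none y).
  by rewrite hE negbK => /eqP->; rewrite mul0r.
move=> x i ix xi rx; have rx' : (r < #|supp x|)%N by rewrite rx.
(* All contributing pairs give the same value of [alpha], so the constant is the total weight. It is
   nonzero as soon as one pair [(y, h)] contributes. *)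
exists (N^-1 * c * (\sum_y \sum_(h | wreath_sum h == (x ^ y)%g) wt h)%N%:R).
  rewrite !mulf_neq0 ?invr_eq0 ?pnatr_eq0 -?lt0n //.
    by apply/card_gt0P; exists 1%g.
  (* A conjugator that moves the cycle [x] into the first block: [p] enumerates [supp x] there, and
     the default of [nth] is not reached on that block. *)
  pose p (k : 'I_(r.+1 + m)) := nth k (enum (supp x)) k.
  have [|s sE] := @perm_extension _ [set lshift m l | l : 'I_r.+1] p.
    move=> _ _ /imsetP[l _ ->] /imsetP[l' _ ->] /eqP.
    have ltl (j : 'I_r.+1) : (j < size (enum (supp x)))%N by rewrite -cardE rx.
    rewrite /p (set_nth_default (lshift m l')) ?nth_uniq ?enum_uniq ?ltl //=.
    by move/eqP=> ll'; apply: val_inj.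
  pose y : wreath G (r.+1 + m) := ([ffun=> 1%g], s).
  have yL l : y.2 (lshift m l) \in supp x.
    by rewrite /= sE ?imset_f // /p -mem_enum mem_nth // -cardE rx /=.
  have [|h hE] := @wreath_sum1_surj G r.+1 m (x ^ y)%g.
    have : [set lshift m l | l : 'I_r.+1] = supp (x ^ y)%g.
      apply/eqP; rewrite eqEcard card_suppJ rx card_imset ?cardsT ?card_ord ?leqnn ?andbT //.
        by apply/subsetP => _ /imsetP[l _ ->]; rewrite suppJ.
      exact: lshift_inj.
    by move->.
  rewrite (bigD1 y) //= addn_gt0 (bigD1 (h, 1%g)) /=; last by rewrite hE.
  rewrite addn_gt0 /wt /= eqxx andbT (_ : _ == _) //.
  rewrite eqEcard finset.subsetT cardsT card_ord /=.
  have -> : #|porbit h.2 ord0| = #|porbit (x ^ y)%g.2 (lshift m ord0)|.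
    by rewrite hE porbit_sum_lshift card_imset //; apply: lshift_inj.
  rewrite -(card_imset _ (@perm_inj _ y.2)) porbitJ.
  have : y.2 (lshift m ord0) \in porbit x.2 i by rewrite -xi.
  by rewrite -eq_porbit_mem => /eqP->; rewrite -xi rx.
move=> alpha cl; rewrite crE -[RHS]mulrA; congr (_ * _).
rewrite natr_sum mulr_suml; apply: eq_bigr => y _.
rewrite natr_sum mulr_suml; apply: eq_bigr => h /eqP hE.
have [->|wt0] := eqVneq (wt h) 0%N; first by rewrite !mul0r.
have [_ h21 full xyE] := wtP x y h rx' hE wt0; congr (_ * _).
rewrite -(color_sum_lshift h.1 h.2) -surjective_pairing hE colorJ cl.
apply: color_porbit => //; rewrite -xi -suppJ xyE -hE [h]surjective_pairing.
by rewrite porbit_sum_lshift full imset_f ?inE.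
Qed.

Lemma P_cycle_like n (i : 'I_n) : cycle_like i (@P F G n i).
Proof.
apply: cycle_like_scale; first by rewrite invr_eq0 pnatr_eq0 -lt0n fact_gt0.
by apply: cycle_like_cast; apply: creation_cycle_like.
Qed.

End Creation.

(** * Irreducible characters span the class functions *)

Section IrreducibleCharacters.
Variables (F : numClosedFieldType) (gT : finGroupType).

Lemma mxtrace_regular_delta (G : {group gT}) x : x \in G ->
  \tr (regular_repr F G x) = (x == 1%g)%:R * #|G|%:R.
Proof.
move=> Gx; have [->|ntx] := eqVneq x 1%g; first by rewrite repr_mx1 mxtrace1 mul1r.
rewrite mul0r [\tr _]big1 // => i _; rewrite 2!mxE /=.
rewrite -(inj_eq enum_val_inj) gring_indexK ?groupM ?enum_valP //.
by rewrite eq_mulVg1 mulKg (negPf ntx).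
Qed.

Lemma irr_char_class (chi : grpalg F gT) : irr_char chi -> class_algebra chi.
Proof.
move=> [d [rG [_ chiE]]] x y; rewrite !chiE conjgE !repr_mxM ?inE //.
by rewrite mxtrace_mulC -mulmxA -repr_mxM ?inE // mulgV repr_mx1 mulmx1.
Qed.

(* Since a class function acts by a scalar on every irreducible representation,
   decomposing the trace of the regular representation expresses it as a
   combination of irreducible characters. *)
Lemma irr_char_span (V : {pred grpalg F gT}) :
    0 \in V -> (forall a, {in V &, forall u v, a *: u + v \in V}) ->
    (forall chi, irr_char chi -> chi \in V) ->
  forall f, class_algebra f -> f \in V.
Proof.
move=> V0 linV irrV f clf; pose G := [set: gT]%G.
have [sG] : inhabited (irrType F G) by split; apply: DecSocleType.
have F'G : pgroup [pchar F]^' G.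
  by apply: sub_in_pnat (pnat_pi (cardG_gt0 _)) => p _ _; rewrite inE /= pchar_num.
have splitG : group_splitting_field F G by apply: group_closure_closed_field.
(* The action on [W] of a central element of the group algebra, hence a scalar by Schur's lemma. *)
pose M (W : sG) : 'M[F]_(irr_degree W) := \sum_h (f h^-1%g : F) *: socle_repr W h.
have scalM W : {a : F | M W = a%:M}.
  apply: sig_eqW; apply/is_scalar_mxP.
  apply: (mx_abs_irr_cent_scalar (splitG _ _ (socle_irr W))).
  apply/centgmxP => x _; rewrite mulmx_suml mulmx_sumr.
  rewrite (reindex_inj (conjg_inj x^-1%g)) /=; apply: eq_bigr => h _.
  rewrite -scalemxAl -scalemxAr -!repr_mxM ?inE // -conjVg clf.
  by rewrite conjgE invgK !mulgA mulgKV.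
pose chi (W : sG) : grpalg F gT := [ffun g => \tr (socle_repr W g)].
have irr_chi (W : sG) : irr_char (chi W).
  exists (\rank (socle_base W))%N, (socle_repr W); split; first exact: socle_irr.
  by move=> g; rewrite ffunE.
have fE : f = \sum_(W : sG) (#|G|%:R^-1 * (irr_degree W)%:R * sval (scalM W)) *: chi W.
  apply/ffunP => g; rewrite sum_ffunE.
  have G0 : #|G|%:R != 0 :> F by rewrite pnatr_eq0 -lt0n cardG_gt0.
  apply: (mulfI G0).
  (* The trace of the regular representation vanishes off the identity, so only [h = g^-1]
     survives. *)
  transitivity (\sum_h f h^-1%g * \tr (regular_repr F G (g * h)%g)).
    rewrite (bigD1 g^-1%g) //= mxtrace_regular_delta ?inE // mulgV eqxx invgK.
    rewrite big1 ?addr0 ?mul1r 1?mulrC // => h hg.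
    rewrite mxtrace_regular_delta ?inE // -eq_invg_mul eq_sym (negPf hg).
    by rewrite mul0r mulr0.
  under eq_bigr => h _ do rewrite (mxtrace_regular_pchar sG) ?inE // mulr_sumr.
  rewrite exchange_big mulr_sumr; apply: eq_bigr => W _.
  rewrite ffunE ffunE.
  transitivity (\tr (socle_repr W g *m M W) *+ irr_degree W).
    rewrite mulmx_sumr raddf_sum /= -sumrMnl; apply: eq_bigr => h _.
    by rewrite -scalemxAr linearZ /= -repr_mxM ?inE // mulrnAr.
  case: (scalM W) => a /= ->; rewrite mul_mx_scalar mxtraceZ -[LHS]mulr_natl.
  by rewrite -[X in _ = _ * X]/(_ * _) !mulrA mulfV // mul1r.
rewrite fE; apply: (big_ind (fun u => u \in V)) => // [u v Vu Vv|W _].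
  by rewrite -[u]scale1r linV.
by rewrite -[_ *: _]addr0 linV // irrV.
Qed.

End IrreducibleCharacters.

(** * Values of powers of Jucys-Murphy elements *)

Section JucysMurphyTerms.
Local Open Scope group_scope.
Variables (G : finGroupType) (n : nat).
Implicit Types (x y : wreath G n) (i j k : 'I_n) (g h : G).

Lemma wact_base i g h k : wact (wreath_base i g) (h, k) =
  ((if k == i then g else 1) * h, k).
Proof. by rewrite /wact /= ffunE perm1. Qed.

Lemma wact_jm_l i j g h : i != j -> wact (jm_term i j g) (h, i) = (g^-1 * h, j).
Proof. by move=> ij; rewrite /wact /= ffunE tpermL eq_sym (negPf ij) eqxx. Qed.

Lemma wact_jm_r i j g h : wact (jm_term i j g) (h, j) = (g * h, i).
Proof. by rewrite /wact /= ffunE tpermR eqxx. Qed.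

Lemma wact_jm_out i j g h k : k != i -> k != j ->
  wact (jm_term i j g) (h, k) = (h, k).
Proof.
move=> ki kj; have tk : tperm i j k = k by rewrite tpermD // eq_sym.
by rewrite /wact /= ffunE tk (negPf ki) (negPf kj) mul1g.
Qed.

Lemma jm_termV i j g : i != j -> (jm_term i j g)^-1 = jm_term i j g.
Proof.
move=> ij; apply/eqP; rewrite eq_invg_mul; apply/eqP; apply: wreath_ext => k.
rewrite wactM wact1; have [->|ki] := eqVneq k i.
  by rewrite wact_jm_l // wact_jm_r mulKVg.
have [->|kj] := eqVneq k j; first by rewrite wact_jm_r wact_jm_l // mulKg.
by rewrite (wact_jm_out g 1 ki kj) wact_jm_out.
Qed.

Lemma supp_jm i j g : supp (jm_term i j g) \subset [set i; j].
Proof.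
apply/subsetP => k; apply: contraLR; rewrite in_set2 negb_or => /andP[ki kj].
by rewrite inE wact_jm_out ?eqxx.
Qed.

Lemma porbit_sub_supp x i (D : {set 'I_n}) :
  i \in D -> supp x \subset D -> porbit x.2 i \subset D.
Proof.
move=> iD sxD; apply/subsetP => _ /porbit_index[m _ ->].
by elim: m => //= m; apply: supp_stable.
Qed.

(** The point [i] is adjoined to the support so that, for [k = 0], the identity is included as
    well. *)
Definition top_cycle (k : nat) i x := [&& i |: supp x == porbit x.2 i,
  #|porbit x.2 i| == k.+1 & [forall l in supp x, (l <= i)%N]].

(** The factor inserts [j] into the cycle just before the return to [i]. The label [g] collected on
    reaching [j] is cancelled by [g^-1] on the way to [i], so the color does not change. *)
Lemma top_cycle_glue x y (k : nat) i j g : j != i -> x = jm_term j i g * y ->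
    top_cycle k i y -> j \notin i |: supp y ->
  [/\ i |: supp x = porbit x.2 i, #|porbit x.2 i| = k.+2,
      color x i = color y i & wact x (1, j) = (g^-1, i)].
Proof.
move=> ji xE /and3P[/eqP yi /eqP ry _] jy.
have xj h : wact x (h, j) = (g^-1 * h, i).
  rewrite xE wactM (@wact_supp _ _ y (h, j)) ?wact_jm_l //=.
  by apply: contra jy => jy; rewrite in_setU jy orbT.
have it m : (m <= k)%N -> iter m (wact x) (1, i) = iter m (wact y) (1, i).
  elim: m => //= m IHm lt_mk; rewrite (IHm (ltnW lt_mk)) xE wactM -iterS.
  rewrite [iter m.+1 _ _]surjective_pairing iter_wact2 wact_jm_out //.
    apply: contraNneq jy => <-; rewrite yi porbit_traject.
    by apply/trajectP; exists m.+1; rewrite ?ry.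
  apply/eqP => miy; have := @index_porbit _ y.2 i m.+1.
  by rewrite ry ltnS miy lt_mk /= eqxx => /(_ isT).
have itk : iter k.+1 (wact x) (1, i) = (g * color y i, j).
  by rewrite iterS it // xE wactM -iterS -ry iter_wact_porbit wact_jm_r.
have itk1 : iter k.+2 (wact x) (1, i) = (color y i, i).
  by rewrite iterS itk xj mulKg.
have sxD : supp x \subset j |: porbit y.2 i.
  rewrite xE; apply: subset_trans (suppM _ _) _.
  rewrite subUset (subset_trans (supp_jm _ _ _)) -yi ?subUset ?sub1set ?in_setU1 ?eqxx ?orbT //.
  by rewrite setUA subsetUr.
have iD : i \in j |: porbit y.2 i by rewrite in_setU1 porbit_id orbT.
have xiE : porbit x.2 i = j |: porbit y.2 i.
  apply/eqP; rewrite eqEsubset porbit_sub_supp //= subUset sub1set.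
  apply/andP; split.
    have /(congr1 snd) := itk; rewrite iter_wact2 => /= <-.
    exact: (mem_porbit_iter _ _ k.+1).
  apply/subsetP => l /porbit_index[m]; rewrite ry ltnS => lemk ->.
  have /(congr1 snd) := it m lemk; rewrite !iter_wact2 => /= <-.
  exact: mem_porbit_iter.
have rx : #|porbit x.2 i| = k.+2 by rewrite xiE cardsU1 -yi jy yi ry.
split=> //; last by rewrite xj mulg1.
  apply/eqP; rewrite eqEsubset subUset sub1set porbit_id {1}xiE sxD /=.
  by apply: porbit_sub_supp; rewrite ?subsetUr ?in_setU1 ?eqxx.
by rewrite /color rx itk1.
Qed.

(** The inverse of gluing: [j] is the point before [i], and [(x.1 i)^-1] is the label that makes [y]
    fix [(1, j)]. *)
Lemma top_cycle_cut x (k : nat) i : top_cycle k.+1 i x ->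
  let j := x.2^-1 i in let y := jm_term j i (x.1 i)^-1 * x in
  [/\ j != i, (j < i)%N, j \notin i |: supp y & top_cycle k i y].
Proof.
case/and3P=> /eqP xi /eqP rx /forall_inP lex j y.
have xj : x.2 j = i by rewrite permKV.
have jE : j = iter k.+1 x.2 i.
  by apply: (@perm_inj _ x.2); rewrite xj -iterS -rx iter_porbit.
have jx : j \in porbit x.2 i by rewrite jE mem_porbit_iter.
have ji : j != i.
  apply/eqP => ji; have := @index_porbit _ x.2 i k.+1.
  by rewrite -jE ji rx ltnSn /= eqxx => /(_ isT).
have lti : (j < i)%N.
  rewrite ltn_neqAle (inj_eq val_inj) ji lex //.
  by move: jx; rewrite -xi in_setU1 (negPf ji).
have jy : j \notin supp y.
  rewrite inE negbK wactM /wact /= xj !mulg1 ffunE tpermR eqxx.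
  by rewrite mulVg.
have jiy : j \notin i |: supp y by rewrite in_setU1 negb_or ji.
have it m : (m <= k)%N -> iter m (wact y) (1, i) = iter m (wact x) (1, i).
  elim: m => //= m IHm lt_mk; rewrite (IHm (ltnW lt_mk)) wactM -iterS.
  have mi m' : (m' < k.+2)%N -> (iter m.+1 x.2 i == iter m' x.2 i) = (m.+1 == m').
    move=> ltm'; apply/eqP/eqP => [mm'|-> //].
    by rewrite -(@index_porbit _ x.2 i m.+1) ?mm' ?index_porbit ?rx // ltnS ltnW.
  rewrite [iter m.+1 _ _]surjective_pairing iter_wact2 wact_jm_out //.
    by rewrite jE mi // eqSS ltn_eqF.
  by rewrite [X in _ != X](_ : _ = iter 0 x.2 i) // mi.
have sxy : porbit x.2 i :\ j \subset porbit y.2 i.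
  apply/subsetP => l /setD1P[lj /porbit_index[m]]; rewrite rx ltnS => lemk lE.
  have {}lemk : (m <= k)%N.
    by rewrite -ltnS ltn_neqAle lemk andbT; apply: contraNneq lj => mk; rewrite lE jE mk.
  have /(congr1 snd) := it m lemk; rewrite !iter_wact2 -lE => /= <-.
  exact: mem_porbit_iter.
have syx : i |: supp y \subset porbit x.2 i :\ j.
  rewrite subsetD1 jiy andbT; apply: subset_trans (_ : _ \subset i |: (supp (jm_term j i (x.1 i)^-1) :|: supp x)) _.
    by rewrite setUS // suppM.
  rewrite subUset sub1set porbit_id subUset -xi subsetUr andbT /=.
  apply: subset_trans (supp_jm _ _ _) _.
  by rewrite subUset !sub1set xi jx porbit_id.
have spy : porbit y.2 i \subset i |: supp y.
  by apply: porbit_sub_supp; rewrite ?subsetUr ?in_setU1 ?eqxx.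
have yi : i |: supp y = porbit y.2 i.
  by apply/eqP; rewrite eqEsubset spy (subset_trans syx sxy).
have yx : porbit y.2 i = porbit x.2 i :\ j.
  by apply/eqP; rewrite eqEsubset sxy -yi syx.
split=> //; apply/and3P; split.
- by rewrite yi.
- by move: rx; rewrite (cardsD1 j) jx -yx add1n => -[->].
apply/forall_inP => l ly; have : l \in i |: supp x.
  have : l \in i |: supp y by rewrite in_setU ly orbT.
  by move/(subsetP syx); rewrite xi => /setD1P[].
by rewrite in_setU1 => /predU1P[->|/lex].
Qed.

End JucysMurphyTerms.

Section XiValue.
Variables (F : fieldType) (G : finGroupType) (n : nat).
Implicit Types (x y : wreath G n) (i j : 'I_n) (alpha : grpalg F G).

Lemma delta_mulE (H : finGroupType) (a x : H) (f : grpalg F H) :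
  (delta F a * f) x = f (a^-1 * x)%g.
Proof.
rewrite ffunE (bigD1 a) //= big1 => [|b ba]; rewrite ffunE ?eqxx ?mul1r ?addr0 //.
by rewrite (negPf ba) mul0r.
Qed.

Lemma porbit_fix (s : 'S_n) i : s i = i -> porbit s i = [set i].
Proof.
move=> si; apply/eqP; rewrite eqEsubset sub1set porbit_id andbT.
apply/subsetP => _ /porbit_index[m _ ->]; apply/set1P.
by elim: m => //= m ->.
Qed.

Lemma top_cycle0 i x :
  top_cycle 0 i x = (x == wreath_base i (color x i)).
Proof.
apply/idP/eqP => [/and3P[/eqP xi /cards1P[i' ri] _]|xE].
  have {i' ri} ri : porbit x.2 i = [set i].
    by have := porbit_id x.2 i; rewrite ri => /set1P->.
  have xii : x.2 i = i by have := mem_porbit_iter x.2 i 1; rewrite ri => /set1P.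
  apply: wreath_ext => k; rewrite wact_base; have [->|ki] := eqVneq k i.
    by rewrite mulg1 -[LHS]/(iter 1 (wact x) (1%g, i)) -iter_wact_porbit ri cards1.
  rewrite mul1g wact_supp //; apply: contra ki => kx; rewrite -in_set1.
  by rewrite -ri -xi in_setU kx orbT.
have ri : porbit x.2 i = [set i] by rewrite porbit_fix // xE perm1.
have sx : supp x \subset [set i].
  apply/subsetP => k; apply: contraLR => ki.
  rewrite inE {1}xE wact_base (negPf (_ : k != i)) ?mul1g ?eqxx //.
  by apply: contra ki => /eqP->; rewrite set11.
apply/and3P; split; first by rewrite ri; apply/eqP/setUidPl.
  by rewrite ri cards1.
by apply/forall_inP => l /(subsetP sx)/set1P->.
Qed.

Lemma color_base i g : color (wreath_base i g : wreath G n) i = g.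
Proof.
rewrite /color porbit_fix ?perm1 // cards1.
by rewrite -[LHS]/((wact (wreath_base i g) (1%g, i)).1) wact_base eqxx mulg1.
Qed.

Lemma copy_atE i alpha x :
  copy_at i alpha x = (top_cycle 0 i x)%:R * alpha (color x i).
Proof.
rewrite sum_ffunE; under eq_bigr => g _ do rewrite !ffunE -[_ *: _]/(_ * _).
rewrite top_cycle0 (bigD1 (color x i)) //= mulrC big1 ?addr0 // => g gx.
case: eqP => [xE|_]; last by rewrite mulr0.
by rewrite xE color_base eqxx in gx.
Qed.

Lemma jm_mulE i (f : grpalg F (wreath G n)) x :
  (jucys_murphy F G i * f) x =
    \sum_(j < n | (j < i)%N) \sum_(g : G) f (jm_term j i g * x)%g.
Proof.
rewrite /jucys_murphy mulr_suml sum_ffunE; apply: eq_bigr => j ji.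
rewrite mulr_suml sum_ffunE; apply: eq_bigr => g _.
by rewrite delta_mulE jm_termV // -(inj_eq val_inj) /= ltn_eqF.
Qed.

(* Up to elements with smaller [i |: supp x], the [i]-th summand of [Xi] is
   [alpha] of the cycle product on the cycles of length [k.+1] with maximum [i]:
   [x] is obtained from exactly one product of [k] terms, cutting [x] before [i]. *)
Lemma Xi_summandE k i alpha x : (k < #|i |: supp x|)%N ->
  (jucys_murphy F G i ^+ k * copy_at i alpha) x =
    (top_cycle k i x)%:R * alpha (color x i).
Proof.
elim: k x => [|k IHk] x; first by rewrite expr0 mul1r copy_atE.
move=> ltk; rewrite exprS -mulrA jm_mulE.
pose y j g : wreath G n := (jm_term j i g * x)%g.
have neq_ji j : (j < i)%N -> j != i by move=> ji; rewrite -(inj_eq val_inj) ltn_eqF.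
have xE j g : (j < i)%N -> x = (jm_term j i g * y j g)%g.
  by move=> /neq_ji ji; rewrite /y -{1}(jm_termV g ji) mulKg.
(* Removing one term loses at most the point [j], so the size hypothesis passes to [y j g] with [k]
   lowered by one. *)
have sxy j g : (j < i)%N -> i |: supp x \subset j |: (i |: supp (y j g)).
  move=> ji; rewrite {1}(xE j g ji) subUset sub1set !in_setU1 eqxx orbT /=.
  apply: subset_trans (suppM _ _) _; rewrite setUA setSU //.
  by apply: subset_trans (supp_jm _ _ _) _; rewrite subUset !sub1set !inE !eqxx orbT.
have IHy j g : (j < i)%N -> (jucys_murphy F G i ^+ k * copy_at i alpha) (y j g) =
    (top_cycle k i (y j g))%:R * alpha (color (y j g) i).
  move=> ji; apply: IHk; have := leq_trans ltk (subset_leq_card (sxy j g ji)).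
  by rewrite cardsU1; case: (j \in _) => // /ltnW.
have glue j g : (j < i)%N -> top_cycle k i (y j g) ->
    [/\ top_cycle k.+1 i x, color x i = color (y j g) i
      & wact x (1%g, j) = (g^-1%g, i)].
  move=> ji topy; have /and3P[/eqP yi /eqP ry /forall_inP ley] := topy.
  have jy : j \notin i |: supp (y j g).
    apply: contraTN ltk => jy; rewrite -leqNgt -ry -yi.
    by apply: leq_trans (subset_leq_card (sxy j g ji)) _; rewrite cardsU1 jy.
  have [xi rx colx xj] := top_cycle_glue (neq_ji j ji) (xE j g ji) topy jy.
  split=> //; apply/and3P; split; rewrite ?xi ?rx //.
  apply/forall_inP => l lx.
  have /(subsetP (sxy j g ji)) : l \in i |: supp x by rewrite in_setU lx orbT.
  by rewrite !in_setU1 => /or3P[/eqP->|/eqP->|/ley //]; rewrite // ltnW.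
have [topx|topx] := boolP (top_cycle k.+1 i x); last first.
  rewrite mul0r big1 // => j ji; rewrite big1 // => g _; rewrite IHy //.
  have [/(glue j g ji)[topx']|_] := boolP (top_cycle k i (y j g)).
    by rewrite topx' in topx.
  by rewrite mul0r.
have [ji lt_ji jy topy] := top_cycle_cut topx.
set j0 := (x.2^-1 i)%g in ji lt_ji jy topy; set g0 := ((x.1 i)^-1)%g in jy topy.
rewrite (bigD1 j0) //= (bigD1 g0) //= IHy // topy.
have [_ -> _] := glue j0 g0 lt_ji topy.
(* By [glue], [x] determines both [j], as the point sent to [i], and [g], as the inverse of its
   label at [i]. *)
have other j g : (j < i)%N -> (j != j0) || (g != g0) -> top_cycle k i (y j g) = false.
  move=> ltj neq; apply: contraTF neq => /(glue j g ltj)[_ _ [xg xj]].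
  rewrite negb_or !negbK /j0 /g0 -xj permK eqxx /=.
  by rewrite xj -[g]invgK -xg mulg1 xj.
rewrite big1 ?addr0 => [|g gg0]; last by rewrite IHy // other ?gg0 ?orbT ?mul0r.
rewrite big1 ?addr0 => [|j /andP[ltj jj0]] //.
by rewrite big1 // => g _; rewrite IHy // other ?jj0 ?mul0r.
Qed.

End XiValue.

(** * Centrality of Xi *)

Section Delta.
Variables (F : fieldType) (H : finGroupType).
Implicit Types (x y : H) (f : grpalg F H).

Lemma deltaM x y : delta F x * delta F y = delta F (x * y)%g.
Proof.
by apply/ffunP => z; rewrite delta_mulE !ffunE -(inj_eq (mulgI x)) mulKVg.
Qed.

Lemma mul_deltaE x f z : (f * delta F x) z = f (z * x^-1)%g.
Proof.
rewrite ffunE (bigD1 (z * x^-1)%g) //= big1 => [|b bz]; rewrite ffunE.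
  by rewrite invMg invgK mulgKV eqxx mulr1 addr0.
rewrite -(inj_eq (mulgI b)) mulKVg -(inj_eq (mulIg x^-1%g)) mulgK eq_sym.
by rewrite (negPf bz) mulr0.
Qed.

Lemma comm_delta_class f :
  (forall x, GRing.comm (delta F x) f) -> class_algebra f.
Proof.
move=> commf x y; have := congr1 (fun u : grpalg F H => u (x * y)%g) (commf y).
by rewrite delta_mulE mul_deltaE mulgK conjgE.
Qed.

End Delta.

Lemma comm_sumr (R : pzRingType) (I : finType) (Q : pred I) (a : R) (u : I -> R) :
  (forall i, Q i -> GRing.comm a (u i)) -> GRing.comm a (\sum_(i | Q i) u i).
Proof.
by move=> au; rewrite /GRing.comm mulr_sumr mulr_suml; apply: eq_bigr => i /au.
Qed.

(* The relation between a simple reflection [s] and two consecutive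
   Jucys-Murphy elements [a] and [b] (a degenerate affine Hecke algebra). *)
Lemma hecke_comm (R : pzRingType) (s a b E A B : R) k :
    s * a = b * s - E -> s * b = a * s + E -> GRing.comm a b ->
    GRing.comm E a -> GRing.comm E b -> s * A = B * s -> s * B = A * s ->
    E * A = E * B ->
  GRing.comm s (a ^+ k * A + b ^+ k * B).
Proof.
move=> sa sb ab Ea Eb sA sB EAB.
(* Here [h] is the divided difference of [a ^+ k] and [b ^+ k], the sum of all monomials of degree
   [k - 1] in [a] and [b]. The two correction terms cancel because [E * A = E * B]. *)
suff [h [sak sbk _ Eh]] : exists h, [/\ s * a ^+ k = b ^+ k * s - E * h,
    s * b ^+ k = a ^+ k * s + E * h, h * (a - b) = a ^+ k - b ^+ k
    & GRing.comm E h].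
  rewrite /GRing.comm mulrDr mulrDl !mulrA sak sbk mulrBl mulrDl.
  rewrite -[b ^+ k * s * A]mulrA sA -[a ^+ k * s * B]mulrA sB Eh.
  by rewrite -[h * E * A]mulrA EAB !mulrA [X in _ + X]addrC addrA subrK addrC.
elim: k => [|k [h [sak sbk hk Eh]]].
  exists 0; rewrite !expr0 !mulr0 !mulr1 !mul1r subr0 addr0 subrr mul0r; split=> //.
  exact: commr0.
have hba : b ^+ k + h * a = a ^+ k + h * b.
  move: hk; rewrite mulrBr => /eqP; rewrite subr_eq => /eqP->.
  by rewrite addrA [b ^+ k + _]addrC subrK.
exists (b ^+ k + h * a); split.
- rewrite exprSr mulrA sak mulrBl -[b ^+ k * s * a]mulrA sa mulrBr mulrA -exprSr.
  by rewrite mulrDr opprD addrA !mulrA; congr (_ - _ - _); apply/esym/commrX.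
- rewrite hba exprSr mulrA sbk mulrDl -[a ^+ k * s * b]mulrA sb mulrDr mulrA -exprSr.
  by rewrite mulrDr addrA !mulrA; congr (_ + _ + _); apply/esym/commrX.
- rewrite mulrBr {1}hba !mulrDl -[h * a * b]mulrA (ab : a * b = b * a) mulrA.
  by rewrite -!exprSr opprD addrACA subrr addr0.
by apply: commrD; [apply: commrX | apply: commrM].
Qed.

Section JucysMurphyRelations.
Variables (F : fieldType) (G : finGroupType) (n : nat).
Implicit Types (w x : wreath G n) (i j l : 'I_n) (alpha : grpalg F G).
Local Notation D := (@delta F (wreath G n)).
Local Notation xi := (jucys_murphy F G).

Definition jm_sum i j : grpalg F (wreath G n) := \sum_(g : G) D (jm_term i j g).

Lemma jm_termC i j (g : G) : i != j -> jm_term j i g = jm_term i j g^-1%g.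
Proof.
move=> ij; apply: wreath_ext => k; have [->|ki] := eqVneq k i.
  by rewrite wact_jm_r wact_jm_l ?invgK.
have [->|kj] := eqVneq k j; last by rewrite !wact_jm_out.
by rewrite wact_jm_r wact_jm_l // eq_sym.
Qed.

Lemma jm_sumC i j : i != j -> jm_sum j i = jm_sum i j.
Proof.
move=> ij; rewrite /jm_sum [RHS](reindex_inj invg_inj) /=.
by apply: eq_bigr => g _; rewrite jm_termC.
Qed.

Lemma jm_term_conj w i j g : i != j ->
  (w * jm_term i j g)%g =
  (jm_term (w.2 i) (w.2 j) (w.1 (w.2 i) * g * (w.1 (w.2 j))^-1) * w)%g.
Proof.
move=> ij; have wij : w.2 i != w.2 j by rewrite (inj_eq perm_inj).
have wE h k : wact w (h, k) = (w.1 (w.2 k) * h, w.2 k)%g by [].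
apply: wreath_ext => k; rewrite !wactM; have [->|ki] := eqVneq k i.
  by rewrite wact_jm_l // !wE wact_jm_l // !mulg1 !invMg invgK !mulgA mulgKV.
have [->|kj] := eqVneq k j.
  by rewrite wact_jm_r !wE wact_jm_r !mulg1 mulgKV.
by rewrite wact_jm_out // wE wact_jm_out ?(inj_eq perm_inj).
Qed.

Lemma delta_jm_sum w i j : i != j ->
  D w * jm_sum i j = jm_sum (w.2 i) (w.2 j) * D w.
Proof.
move=> ij; rewrite mulr_sumr mulr_suml.
rewrite [RHS](reindex_inj (mulIg (w.1 (w.2 j))^-1%g)) /=.
rewrite [RHS](reindex_inj (mulgI (w.1 (w.2 i))%g)) /=.
by apply: eq_bigr => g _; rewrite !deltaM jm_term_conj.
Qed.

(** Conjugation by [w] permutes the sums [jm_sum i j] over [i < j], whatever its labels. *)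
Lemma delta_jm_comm w j : w.2 j = j -> (forall i, (w.2 i < j)%N = (i < j)%N) ->
  GRing.comm (D w) (xi j).
Proof.
move=> wj stw; rewrite /GRing.comm /jucys_murphy mulr_sumr mulr_suml.
rewrite [RHS](reindex_inj (@perm_inj _ w.2)) /=.
rewrite [RHS](eq_bigl (fun i : 'I_n => i < j)%N) //.
apply: eq_bigr => i ij; rewrite -/(jm_sum i j) -/(jm_sum (w.2 i) j) -{2}wj.
by rewrite delta_jm_sum // -(inj_eq val_inj) ltn_eqF.
Qed.

Lemma delta_base_jm_comm w j : w.2 = 1%g -> GRing.comm (D w) (xi j).
Proof. by move=> w1; apply: delta_jm_comm => [|i]; rewrite w1 perm1. Qed.

(** Each term of [xi i] fixes the position [j] and preserves the positions below [j], so
    [delta_jm_comm] applies to it. *)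
Lemma jm_comm_lt i j : (i < j)%N -> GRing.comm (xi i) (xi j).
Proof.
move=> ij; apply/commr_sym/comm_sumr => l li; apply: comm_sumr => g _.
apply/commr_sym/delta_jm_comm => [|k] /=.
  by rewrite tpermD // -(inj_eq val_inj) ltn_eqF // (ltn_trans li).
case: tpermP => [->|->|//]; first by rewrite ij (ltn_trans li).
by rewrite ij (ltn_trans li).
Qed.

Lemma delta_copy w i alpha : class_algebra alpha ->
  D w * copy_at i alpha = copy_at (w.2 i) alpha * D w.
Proof.
move=> cl; rewrite mulr_sumr mulr_suml.
rewrite [RHS](reindex_inj (conjg_inj (w.1 (w.2 i))^-1%g)) /=.
apply: eq_bigr => g _; rewrite cl -scalerAr -scalerAl !deltaM; congr (_ *: D _).
apply: wreath_ext => k; rewrite !wactM wact_base mulg1.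
rewrite [X in _ = wact _ X]/wact /= mulg1 wact_base (inj_eq perm_inj) /wact /=.
have [->|_] := eqVneq k i; rewrite ?mulg1 ?mul1g //.
by rewrite conjgE invgK !mulgA mulgKV.
Qed.

(** The substitution of [h * g] for [g] trades the base element [h] at [i] for its conjugate [h ^ g]
    at [j], which a class function does not distinguish from [h]. *)
Lemma jm_sum_copy i j alpha : i != j -> class_algebra alpha ->
  jm_sum i j * copy_at i alpha = jm_sum i j * copy_at j alpha.
Proof.
move=> ij cl; have swap (g h : G) : (jm_term i j (h * g) * wreath_base i h =
    jm_term i j g * wreath_base j (h ^ g))%g.
  apply: wreath_ext => k; rewrite !wactM !wact_base !mulg1.
  have [->|ki] := eqVneq k i.
    by rewrite (negPf ij) !wact_jm_l // invMg mulgKV mulg1.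
  have [->|kj] := eqVneq k j; last by rewrite !wact_jm_out.
  by rewrite !wact_jm_r mulg1 conjgE mulKVg.
transitivity (\sum_(g : G) \sum_(h : G) alpha h *: D (jm_term i j g * wreath_base j (h ^ g))%g).
  rewrite [RHS]exchange_big mulr_sumr; apply: eq_bigr => h _ /=.
  rewrite mulr_suml (reindex_inj (mulgI h)) /=; apply: eq_bigr => g _.
  by rewrite -scalerAr deltaM swap.
rewrite mulr_suml; apply: eq_bigr => g _; rewrite mulr_sumr.
rewrite [RHS](reindex_inj (conjg_inj g)) /=; apply: eq_bigr => h _.
by rewrite -scalerAr deltaM cl.
Qed.

(** The summands at [l] and [l1] are treated together by [hecke_comm]; every other summand commutes
    with the transposition by itself. *)
Lemma Xi_adjacent_comm k alpha l l1 : class_algebra alpha -> l1 = l.+1 :> nat ->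
  GRing.comm (D (jm_term l l1 1%g)) (Xi n k alpha).
Proof.
move=> cl l1E; set s := jm_term l l1 1%g.
have ll1 : l != l1 by rewrite -(inj_eq val_inj) /= l1E ltn_eqF.
have s2 i : s.2 i = tperm l l1 i by [].
have out i : i != l -> i != l1 -> s.2 i = i.
  by move=> il il1; rewrite s2 tpermD // eq_sym.
have sl : s.2 l = l1 by rewrite s2 tpermL.
have sl1 : s.2 l1 = l by rewrite s2 tpermR.
have ltl1 (i : 'I_n) : (i < l1)%N = (i == l) || (i < l)%N.
  by rewrite l1E ltnS leq_eqVlt (inj_eq val_inj).
have lt_neq (i : 'I_n) : (i < l)%N -> i != l /\ i != l1.
  by move=> il; rewrite -!(inj_eq val_inj) /= !ltn_eqF // l1E ltnS ltnW.
(* The terms of [E] have trivial permutation part, so [E] commutes with every Jucys-Murphy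
   element. *)
pose T := jm_sum l l1; pose E := T * D s.
have xil1 : xi l1 = T + \sum_(i < n | (i < l)%N) jm_sum i l1.
  rewrite /jucys_murphy (bigD1 l) /=; last by rewrite ltl1 eqxx.
  congr (_ + _); apply: eq_bigl => i; rewrite ltl1.
  by case: eqVneq => [->|]; rewrite ?ltnn ?andbT.
have D_xil : D s * xi l = xi l1 * D s - E.
  rewrite xil1 mulrDl addrC addKr mulr_sumr mulr_suml.
  apply: eq_bigr => i /lt_neq[il il1].
  by rewrite -/(jm_sum i l) delta_jm_sum // sl out.
have D_xil1 : D s * xi l1 = xi l * D s + E.
  rewrite xil1 mulrDr delta_jm_sum // sl sl1 jm_sumC // addrC; congr (_ + _).
  rewrite mulr_sumr mulr_suml; apply: eq_bigr => i /lt_neq[il il1].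
  by rewrite delta_jm_sum // sl1 out.
have Exi j : GRing.comm E (xi j).
  apply: commr_sym; rewrite /E mulr_suml; apply: comm_sumr => g _.
  rewrite deltaM; apply/commr_sym/delta_base_jm_comm.
  by apply/permP => i; rewrite wreath_mul2E perm1 tpermK.
have sA i : D s * copy_at i alpha = copy_at (s.2 i) alpha * D s by apply: delta_copy.
rewrite /Xi (bigD1 l) //= (bigD1 l1) 1?eq_sym //= addrA.
apply: commrD; last first.
  apply: comm_sumr => i /andP[il il1]; apply: commrM; last first.
    by rewrite /GRing.comm sA out.
  apply: commrX; apply: delta_jm_comm; first exact: out.
  have l1i : (l1 < i)%N = (l < i)%N.
    by rewrite [RHS]leq_eqVlt -l1E (inj_eq val_inj) eq_sym (negPf il1).
  by move=> j; rewrite s2; case: tpermP => [->|->|].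
apply: hecke_comm D_xil D_xil1 _ (Exi _) (Exi _) _ _ _.
- by apply: jm_comm_lt; rewrite l1E.
- by rewrite sA sl.
- by rewrite sA sl1.
rewrite /E -!mulrA !sA sl sl1 !mulrA.
by rewrite jm_sum_copy.
Qed.

(** It suffices to commute with the base group and the adjacent transpositions, which generate the
    wreath product. *)
Lemma Xi_class k alpha : class_algebra alpha -> class_algebra (Xi n k alpha).
Proof.
move=> cl; apply: comm_delta_class => w; apply: commr_sym.
have commM x y : GRing.comm (Xi n k alpha) (D x) -> GRing.comm (Xi n k alpha) (D y) ->
    GRing.comm (Xi n k alpha) (D (x * y)%g).
  by move=> cx cy; rewrite -deltaM; apply: commrM.
have commB (b : {ffun 'I_n -> G}) : GRing.comm (Xi n k alpha) (D (b, 1%g)).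
  apply/commr_sym/comm_sumr => i _; apply: commrM.
    by apply/commrX/delta_base_jm_comm.
  by rewrite /GRing.comm delta_copy //= perm1.
pose pw (s : 'S_n) : wreath G n := ([ffun=> 1%g], s).
have pwM s t : pw (s * t)%g = (pw t * pw s)%g.
  by congr (_, _); apply/ffunP => i; rewrite !ffunE mulg1.
have pw_jm i j : pw (tperm i j) = jm_term i j 1%g.
  by congr (_, _); apply/ffunP => l; rewrite !ffunE invg1 !if_same.
(* Induction on the distance: the transposition of [i] and [j] is conjugate to that of [i] and
   [j - 1] by an adjacent one. *)
have commT d i j : (j = i + d.+1 :> nat)%N ->
    GRing.comm (Xi n k alpha) (D (pw (tperm i j))).
  elim: d j => [|d IHd] j jE.
    by rewrite pw_jm; apply/commr_sym/Xi_adjacent_comm; rewrite // jE addn1.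
  have ltj : (j.-1 < n)%N by apply: leq_ltn_trans (leq_pred j) (ltn_ord j).
  pose j' := Ordinal ltj.
  have j'E : j' = (i + d.+1)%N :> nat by rewrite /= jE addnS.
  have -> : tperm i j = (tperm i j' ^ tperm j' j)%g.
    have ij' : (i < j')%N by rewrite j'E -addSnnS leq_addr.
    have ij : (i < j)%N by apply: leq_trans ij' (leq_pred j).
    by rewrite tpermJ tpermL tpermD // -(inj_eq val_inj) gtn_eqF.
  rewrite conjgE tpermV !pwM; have adj : GRing.comm (Xi n k alpha) (D (pw (tperm j' j))).
    by rewrite pw_jm; apply/commr_sym/Xi_adjacent_comm; rewrite //= jE addnS.
  by apply: (commM) => //; apply: (commM) => //; apply: IHd.
have commT' i j : GRing.comm (Xi n k alpha) (D (pw (tperm i j))).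
  have [ij|ji|/val_inj->] := ltngtP i j; last by rewrite tperm1; apply: (commB).
    by apply: (commT (j - i).-1); rewrite prednK ?subn_gt0 ?subnKC // ltnW.
  by rewrite tpermC; apply: (commT (i - j).-1); rewrite prednK ?subn_gt0 ?subnKC // ltnW.
have -> : w = (((w.1, 1%g) : wreath G n) * pw w.2)%g.
  by apply: wreath_ext => i; rewrite wactM /wact /= !ffunE perm1 !mulg1.
apply: (commM) => //; have [ts -> _] := prod_tpermP w.2.
elim: ts => [|[i j] ts IHts]; first by rewrite big_nil; apply: (commB).
by rewrite big_cons /= pwM; apply: (commM).
Qed.

End JucysMurphyRelations.

(** * Generation *)

Section XiCycleLike.
Variables (F : numFieldType) (G : finGroupType) (n : nat).

Lemma copy_at_linear (i : 'I_n) a (u v : grpalg F G) :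
  copy_at i (a *: u + v) = a *: copy_at i u + copy_at i v.
Proof.
rewrite /copy_at scaler_sumr -big_split; apply: eq_bigr => g _ /=.
by rewrite ffunE grpalgZE scalerDl scalerA.
Qed.

Lemma Xi_linear k a (u v : grpalg F G) :
  Xi n k (a *: u + v) = a *: Xi n k u + Xi n k v.
Proof.
rewrite /Xi scaler_sumr -big_split; apply: eq_bigr => i _ /=.
by rewrite copy_at_linear mulrDr scalerAr.
Qed.

(** By [Xi_summandE] the [i]-th summand sees the cycles with maximum [i]. A cycle has one maximum,
    so exactly one summand contributes, with constant 1. *)
Lemma Xi_cycle_like k : cycle_like k (@Xi F G n k).
Proof.
have XiE (alpha : grpalg F G) (x : wreath G n) : (k < #|supp x|)%N ->
    Xi n k alpha x = \sum_i (top_cycle k i x)%:R * alpha (color x i).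
  move=> kx; rewrite sum_ffunE; apply: eq_bigr => i _; apply: Xi_summandE.
  by apply: leq_trans kx _; apply: subset_leq_card; apply: subsetUr.
have topP (i : 'I_n) (x : wreath G n) : (k < #|supp x|)%N -> top_cycle k i x ->
    [/\ i \in supp x, supp x = porbit x.2 i, #|supp x| = k.+1
      & {in supp x, forall l : 'I_n, (l <= i)%N}].
  move=> kx /and3P[/eqP xi /eqP ri /forall_inP lei].
  have sx : supp x = porbit x.2 i.
    by apply/eqP; rewrite eqEcard ri kx -xi subsetUr.
  by split=> //; rewrite sx // porbit_id.
split; first exact: Xi_linear.
- exact: Xi_class.
- move=> alpha x cl kx; rewrite XiE //.
  have [i /(topP i x kx)[ix sx rx _] _|none] := pickP (fun i => top_cycle k i x).
    by split=> //; exists i.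
  by rewrite big1 ?eqxx // => i _; rewrite none mul0r.
move=> x i ix sx rx; exists 1; first exact: oner_neq0.
move=> alpha cl; have kx : (k < #|supp x|)%N by rewrite rx.
rewrite XiE // mul1r.
case: (arg_maxnP (fun l : 'I_n => l : nat) ix) => m mx maxm.
have mi : m \in porbit x.2 i by rewrite -sx.
have sxm : supp x = porbit x.2 m.
  by rewrite sx; apply/eqP; rewrite eq_porbit_mem porbit_sym.
have topm : top_cycle k m x.
  apply/and3P; split; last by apply/forall_inP => l; apply: maxm.
    by rewrite -sxm; apply/eqP/setUidPr; rewrite sub1set.
  by rewrite -sxm rx.
rewrite (bigD1 m) //= topm mul1r big1 ?addr0 => [|l lm].
  exact: (color_porbit cl).
have [/(topP l x kx)[lx _ _ maxl]|] := boolP (top_cycle k l x); last by rewrite mul0r.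
case/eqP: lm; apply/val_inj/eqP; rewrite eqn_leq.
by rewrite (maxl m mx) andbT; apply: maxm.
Qed.

End XiCycleLike.

Local Open Scope classical_set_scope.

Section Generation.
Variables (F : numClosedFieldType) (G : finGroupType) (n : nat).

Lemma class_subalg_closed (H : finGroupType) :
  GRing.subalg_closed [in (class_algebra (F := F) (G := H))].
Proof.
split; first exact/mem_set/class_algebra1.
  by move=> a u v /set_mem clu /set_mem clv; exact/mem_set/class_algebra_linear.
by move=> u v /set_mem clu /set_mem clv; exact/mem_set/conv_class.
Qed.

Lemma generated_cycle_like (fam : 'I_n -> grpalg F G -> grpalg F (wreath G n)) :
  (forall i : 'I_n, cycle_like i (fam i)) ->
  generated_algebra [set u : grpalg F (wreath G n) |
      exists (i : 'I_n) (alpha : grpalg F G), irr_char alpha /\ u = fam i alpha]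
    = class_algebra (F := F) (G := wreath G n).
Proof.
move=> famP; apply/seteqP; split.
  apply: smallest_sub; first exact: class_subalg_closed.
  move=> _ [i [alpha [irr_alpha ->]]]; have [_ clf _ _] := famP i.
  exact/clf/irr_char_class.
move=> f clf B [algB genB].
have [B1 linB mulB] := algB.
have [C1 linC mulC] := class_subalg_closed (wreath G n).
(* A subalgebra containing the generators may contain more than class functions; it is cut down so
   that [cycle_like_generate] applies. *)
pose B' := [pred b | (b \in B) && (b \in class_algebra (F := F) (G := wreath G n))].
suff /andP[/set_mem] : f \in B' by [].
have algB' : GRing.subalg_closed B'.
  split; first exact/andP.
    move=> a u v /andP[uB uC] /andP[vB vC]; apply/andP.
    by split; [apply: linB | apply: linC].
  move=> u v /andP[uB uC] /andP[vB vC]; apply/andP.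
  by split; [apply: mulB | apply: mulC].
apply: (cycle_like_generate algB') clf => // [b /andP[_ /set_mem]//|i alpha].
have [linf clf _ _] := famP i.
(* By linearity the functions that [fam i] sends into [B'] form a subspace; it contains the
   irreducible characters, hence all class functions. *)
apply: (irr_char_span (V := [pred u | fam i u \in B'])) => [|a u v|chi irr_chi].
- have := linf (-1) 0 0; rewrite scaler0 addr0 scaleN1r addNr => fam0.
  by change (fam i 0 \in B'); rewrite fam0; apply: subalg0.
- move=> uB vB; change (fam i (a *: u + v) \in B').
  by rewrite linf; apply: subalg_lin.
apply/andP; split; apply/mem_set; last exact/clf/irr_char_class.
by apply: genB; exists i, chi.
Qed.

End Generation.

Theorem theorem5p10 (R : realType) (Gamma : finGroupType) (n : nat)
    (n_ge1 : (1 <= n)%N) :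
  generated_algebra
    [set u : grpalg R[i] (wreath Gamma n) |
       exists (i : 'I_n) (alpha : grpalg R[i] Gamma),
         irr_char alpha /\ u = Xi n i alpha]
    = class_algebra (F := R[i]) (G := wreath Gamma n)
  /\
  generated_algebra
    [set u : grpalg R[i] (wreath Gamma n) |
       exists (i : 'I_n) (alpha : grpalg R[i] Gamma),
         irr_char alpha /\ u = P i alpha]
    = class_algebra (F := R[i]) (G := wreath Gamma n).
Proof.
split.
  apply: (@generated_cycle_like R[i] Gamma n (fun i => @Xi R[i] Gamma n i)) => i.
  exact: Xi_cycle_like.
apply: (@generated_cycle_like R[i] Gamma n (@P R[i] Gamma n)) => i.
exact: P_cycle_like.
Qed.
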